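(* Suppose $X$ is one of the Banach spaces $c_0$ or $\ell_p$ for $1 \leq p \leq \infty$. Then $X$ has the SHAI property.
   Context: All Banach spaces are over $\mathbb{C}$. For a Banach space $X$, $\mathcal{B}(X)$ denotes the algebra of bounded linear operators on $X$. The spaces $c_0$ and $\ell_p$ are the classical sequence spaces indexed by $\mathbb{N}$. A Banach space $X$ has the SHAI property (Surjective Homomorphisms Are Injective) if for every non-zero Banach space $Y$, every surjective algebra homomorphism $\psi: \mathcal{B}(X) \rightarrow \mathcal{B}(Y)$ (a linear multiplicative map; continuity is not assumed) is injective. *)

(* Defs.v *)
From HB Require Import structures.
From mathcomp Require Import all_boot all_order all_algebra complex.
From mathcomp Require Import all_classical all_reals all_analysis.

Set Implicit Arguments.
Unset Strict Implicit.
Unset Printing Implicit Defensive.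

Import Order.TTheory GRing.Theory Num.Theory.
Import numFieldNormedType.Exports.
Import Normc.

Local Open Scope classical_set_scope.
Local Open Scope ring_scope.
Local Open Scope complex_scope.

Section BoundedOperators.
Context {K : numFieldType}.

(* When K = R[i] and X is not zero, the inequality forces M to be real and
   nonnegative, the order of R[i] being partial. *)
Definition bounded_operator (X : normedModType K) : {pred X -> X} :=
  [pred T : X -> X | `[< linear T /\ exists M, forall x, `|T x| <= M * `|x| >]].
Arguments bounded_operator : clear implicits.

Record bop (X : normedModType K) := Bop {
  bop_val :> X -> X;
  bop_valP : bop_val \in bounded_operator X }.
Arguments bop : clear implicits.

Context {X : normedModType K}.
Implicit Types S T : bop X.

Lemma bop_linear T : linear T.
Proof. by have /asboolP[] := bop_valP T. Qed.

Lemma bop_bounded T : exists M, forall x, `|T x| <= M * `|x|.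
Proof. by have /asboolP[] := bop_valP T. Qed.

HB.instance Definition _ T := GRing.isLinear.Build K X X *:%R T (bop_linear T).

HB.instance Definition _ := [isSub for @bop_val X].
HB.instance Definition _ := [Choice of bop X by <:].

Lemma bounded_operator_submod_closed : submod_closed (bounded_operator X).
Proof.
split=> [|a f g].
  apply/asboolP; split=> [b x y|].
    by have : (0 : X) = b *: (0 : X) + (0 : X) by rewrite scaler0 addr0.
  by exists 0 => x; rewrite [X in `|X|]/(0 : X) normr0 mul0r.
move=> /asboolP[lf [M fM]] /asboolP[lg [N gN]]; apply/asboolP; split.
  move=> b x y; suff : a *: f (b *: x + y) + g (b *: x + y) =
    b *: (a *: f x + g x) + (a *: f y + g y) by [].
  by rewrite lf lg !scalerDr !scalerA mulrC addrACA.
exists (`|a| * M + N) => x; rewrite [X in `|X|]/(a *: f x + g x) (le_trans (ler_normD _ _))//.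
by rewrite mulrDl lerD// normrZ -mulrA ler_wpM2l.
Qed.

HB.instance Definition _ := GRing.isSubmodClosed.Build K (X -> X)
  (bounded_operator X) bounded_operator_submod_closed.
HB.instance Definition _ := [SubChoice_isSubLmodule of bop X by <:].

Lemma bop_id_subproof : @idfun X \in bounded_operator X.
Proof.
by apply/asboolP; split=> [b x y //|]; exists 1 => x; rewrite mul1r.
Qed.

Lemma bop_comp_subproof S T : S \o T \in bounded_operator X.
Proof.
apply/asboolP; split=> [b x y|]; first by rewrite /= !bop_linear.
have [[M SM] [N TN]] := (bop_bounded S, bop_bounded T).
exists (`|M| * N) => x /=.
rewrite (le_trans (SM _))// (@le_trans _ _ (`|M| * `|T x|))//.
  have [->|Tx0] := eqVneq (T x) 0; first by rewrite normr0 !mulr0.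
  have Tx_gt0 : 0 < `|T x| by rewrite normr_gt0.
  by rewrite ger0_norm// -(pmulr_lge0 _ Tx_gt0) (le_trans _ (SM _)).
by rewrite -mulrA ler_wpM2l.
Qed.

Definition bop_id : bop X := Bop bop_id_subproof.
Definition bop_comp S T : bop X := Bop (bop_comp_subproof S T).

Lemma bopP S T : S = T <-> S =1 T.
Proof. by split=> [->//|ST]; exact/val_inj/funext. Qed.

Lemma bop_compA : associative bop_comp.
Proof. by move=> S T U; apply/bopP. Qed.
Lemma bop_comp1l : left_id bop_id bop_comp.
Proof. by move=> S; apply/bopP. Qed.
Lemma bop_comp1r : right_id bop_id bop_comp.
Proof. by move=> S; apply/bopP. Qed.
Lemma bop_compDl : left_distributive bop_comp +%R.
Proof. by move=> S T U; apply/bopP. Qed.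
Lemma bop_compDr : right_distributive bop_comp +%R.
Proof. by move=> S T U; apply/bopP => x; exact: linearD. Qed.

(* Multiplication is composition.  [bop X] is only a [pzRingType] because the
   library's algebra structures exclude the zero ring, i.e. the case X = 0;
   the two remaining algebra laws are [bop_scalerAl] and [bop_scalerAr]. *)
HB.instance Definition _ := GRing.Zmodule_isPzRing.Build (bop X)
  bop_compA bop_comp1l bop_comp1r bop_compDl bop_compDr.

Lemma bop_scalerAl (a : K) S T : a *: (S * T) = (a *: S) * T.
Proof. by apply/bopP. Qed.
Lemma bop_scalerAr (a : K) S T : a *: (S * T) = S * (a *: T).
Proof. by apply/bopP => x; exact: esym (linearZZ S a (T x)). Qed.

End BoundedOperators.

Section LpNorm.
Context {R : realType}.
(* The regular module R[i]^o carries the library's topology on a numFieldType,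
   which the bare type R[i] does not. *)
Local Notation C := R[i]^o.
Implicit Types (x y l : nat -> C) (p : \bar R) (r : R).

(* Only used for 1 <= p <= +oo; the value at p = -oo is a placeholder. *)
Definition lnorm p x : \bar R :=
  match p with
  | r%:E => ((\sum_(n <oo) (normc (x n) `^ r)%:E) `^ r^-1)%E
  | +oo%E => ereal_sup (range (fun n => (normc (x n))%:E))
  | -oo%E => 0%E
  end.

Lemma normc_ge0 (z : C) : 0 <= normc z.
Proof. by case: z => a b; exact: sqrtr_ge0. Qed.

Lemma normrcE (z : C) : `|z| = (normc z)%:C.
Proof. by case: z. Qed.

Lemma lee_poweR r (a b : \bar R) : 0 <= r -> (0 <= a)%E -> (a <= b)%E ->
  (a `^ r <= b `^ r)%E.
Proof.
move=> r0 a0 ab; apply: gt0_ler_poweR => //; rewrite in_itv/= leey andbT//.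
exact: le_trans ab.
Qed.

Lemma epowR_ge0 (a r : R) : (0 <= (a `^ r)%:E)%E.
Proof. by rewrite lee_fin powR_ge0. Qed.

Lemma lsum_ge0 r x : (0 <= \sum_(n <oo) (normc (x n) `^ r)%:E)%E.
Proof. by apply: nneseries_ge0 => *; exact: epowR_ge0. Qed.

Lemma lnorm_ge0 p x : (0 <= lnorm p x)%E.
Proof.
case: p => [r||//]; first exact: poweR_ge0.
apply: le_ereal_sup_tmp; exists (normc (x 0))%:E; first by exists 0%N.
by rewrite lee_fin normc_ge0.
Qed.

Lemma ler_lnorm p x y : (forall n, normc (x n) <= normc (y n)) -> (1 <= p)%E ->
  (lnorm p x <= lnorm p y)%E.
Proof.
move=> xy; case: p => [r||//] p1 /=.
  have r0 : 0 < r by rewrite (lt_le_trans ltr01).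
  have xyr n : ((normc (x n) `^ r)%:E <= (normc (y n) `^ r)%:E)%E.
    by rewrite -!poweR_EFin lee_poweR ?lee_fin ?normc_ge0// ltW.
  rewrite lee_poweR ?lsum_ge0 ?invr_ge0 ?(ltW r0)//.
  by apply: lee_nneseries => n *; [exact: epowR_ge0|exact: xyr].
apply: ge_ereal_sup => _ [n _ <-]; apply: le_ereal_sup_tmp.
by exists (normc (y n))%:E; [exists n|rewrite lee_fin].
Qed.

Lemma lnormE r x : 0 < r ->
  lnorm r%:E x = 'N[@counting nat R]_r%:E[EFin \o (@normc R \o x)]%E.
Proof.
move=> r0; rewrite Lnorm_counting//=; congr (_ `^ _)%E.
apply: eq_eseriesr => n _ /=.
by rewrite ger0_norm ?normc_ge0.
Qed.

Lemma lnormD p x y : (1 <= p)%E -> (lnorm p (x + y)%R <= lnorm p x + lnorm p y)%E.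
Proof.
case: p => [r||//] p1.
  have r0 : 0 < r by rewrite (lt_le_trans ltr01).
  pose z n : C := (normc (x n) + normc (y n))%:C.
  have zE n : normc (z n) = normc (x n) + normc (y n).
    by rewrite /= expr0n addr0 sqrtr_sqr ger0_norm// addr_ge0 ?normc_ge0.
  apply: (@le_trans _ _ (lnorm r%:E z)).
    by apply: ler_lnorm => // n; rewrite zE; exact: le_normcD.
  rewrite !lnormE//; have -> : @normc R \o z =
      ((@normc R \o x) \+ (@normc R \o y))%R by apply/funext => n; exact: zE.
  exact: (@eminkowski _ _ _ (@counting nat R)).
apply: ge_ereal_sup => _ [n _ <-].
rewrite (@le_trans _ _ ((normc (x n))%:E + (normc (y n))%:E)%E)//.
  by rewrite -EFinD lee_fin; exact: le_normcD.
by apply: leeD; apply: le_ereal_sup_tmp; eexists; try exact: lexx; exists n.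
Qed.

Lemma lnormZ p (a : R[i]) x : (1 <= p)%E ->
  (lnorm p (a *: x)%R = (normc a)%:E * lnorm p x)%E.
Proof.
case: p => [r||//] p1 /=.
  have r0 : 0 < r by rewrite (lt_le_trans ltr01).
  under eq_eseriesr => n _.
    rewrite [X in normc X]/(a * x n) normcM powRM ?normc_ge0// EFinM.
    over.
  rewrite nneseriesZl; last by move=> i _; rewrite lee_fin powR_ge0.
  rewrite poweRM ?epowR_ge0 ?lsum_ge0//.
  by rewrite poweR_EFin -powRrM mulfV ?gt_eqF// powRr1 ?normc_ge0.
rewrite -ereal_supZl ?normc_ge0//; last first.
  by apply/set0P; exists (normc (x 0))%:E; exists 0%N.
by rewrite image_comp; congr ereal_sup; apply: eq_imagel => n _ /=;
   rewrite [X in normc X]/(a * x n) normcM EFinM.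
Qed.

Lemma lnorm0 p : (1 <= p)%E -> lnorm p 0 = 0%E.
Proof. by move=> p1; rewrite -(scale0r 0) lnormZ// normc0 mul0e. Qed.

Lemma lnormN p x : (1 <= p)%E -> lnorm p (- x) = lnorm p x.
Proof.
by move=> p1; rewrite -scaleN1r lnormZ// normcN normc1 mul1e.
Qed.

Lemma normc_le_lnorm p x n : (1 <= p)%E -> ((normc (x n))%:E <= lnorm p x)%E.
Proof.
case: p => [r||//] p1 /=; last first.
  by apply: le_ereal_sup_tmp; eexists; try exact: lexx; exists n.
have r0 : 0 < r by rewrite (lt_le_trans ltr01).
rewrite -[leLHS]poweRe1 ?lee_fin ?normc_ge0// -(@mulfV _ r) ?gt_eqF// poweRrM.
rewrite poweR_EFin.
apply: lee_poweR; rewrite ?invr_ge0 ?epowR_ge0 ?(ltW r0)//.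
rewrite (@nneseriesD1 _ _ n)//; last by move=> *; exact: epowR_ge0.
by rewrite leeDl//; apply: nneseries_ge0 => *; exact: epowR_ge0.
Qed.

Definition trunc K x : nat -> C := fun n => if (n < K)%N then x n else 0.

Lemma lnorm_trunc_sup p x (e : \bar R) : (1 <= p)%E ->
  (forall K, (lnorm p (trunc K x) <= e)%E) -> (lnorm p x <= e)%E.
Proof.
case: p => [r||//] p1 xe /=; last first.
  apply: ge_ereal_sup => _ [n _ <-]; apply: le_trans (xe n.+1).
  apply: le_ereal_sup_tmp; exists (normc (trunc n.+1 x n))%:E; first by exists n.
  by rewrite /trunc ltnSn.
have r0 : 0 < r by rewrite (lt_le_trans ltr01).
have e0 : (0 <= e)%E by rewrite (le_trans (lnorm_ge0 r%:E (trunc 0 x))).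
suff : (\sum_(n <oo) (normc (x n))%:E `^ r <= e `^ r)%E.
  move=> h; have -> : e = ((e `^ r) `^ r^-1)%E.
    by rewrite -poweRrM mulfV ?gt_eqF// poweRe1.
  by apply: lee_poweR; rewrite ?invr_ge0 ?lsum_ge0 ?(ltW r0).
apply: lime_le; first by apply: is_cvg_nneseries => *; exact: epowR_ge0.
apply: nearW => K.
apply: (@le_trans _ _ (lnorm r%:E (trunc K x) `^ r)%E); last first.
  by rewrite lee_poweR ?lnorm_ge0 ?(ltW r0).
rewrite /= -poweRrM mulVf ?gt_eqF// poweRe1 ?lsum_ge0//.
apply: le_trans (nneseries_lim_ge K _) => /=; last by move=> *; exact: epowR_ge0.
by rewrite big_nat [leRHS]big_nat; apply: lee_sum => n /andP[_ nK];
  rewrite /trunc nK.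
Qed.

Lemma lnorm_trunc_le p K x : (1 <= p)%E ->
  (lnorm p (trunc K x) <= (\sum_(n < K) normc (x n))%:E)%E.
Proof.
move=> p1; elim: K => [|K IH].
  by rewrite big_ord0 (_ : trunc 0 x = 0%R) ?lnorm0.
rewrite big_ord_recr/= EFinD.
pose d : nat -> C := fun n => if n == K then x K else 0.
have -> : trunc K.+1 x = (trunc K x + d)%R.
  apply/funext => n.
  suff : trunc K.+1 x n = (trunc K x n + d n)%R by [].
  rewrite /trunc /d ltnS leq_eqVlt.
  by have [->|_] := eqVneq n K; rewrite ?ltnn/= ?add0r ?addr0.
apply: le_trans (lnormD _ _ p1) _; apply: leeD => //.
have dE n : n != K -> normc (d n) = 0 by rewrite /d => /negbTE->; exact: normc0.
have dK : normc (d K) = normc (x K) by rewrite /d eqxx.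
case: p p1 {IH} => [r||//] p1 /=; last first.
  apply: ge_ereal_sup => _ [n _ <-]; rewrite lee_fin.
  by have [->|/dE->] := eqVneq n K; rewrite ?dK ?normc_ge0.
have r0 : 0 < r by rewrite (lt_le_trans ltr01).
rewrite (@nneseriesD1 _ _ K)//; last by move=> *; exact: epowR_ge0.
rewrite eseries0 ?adde0; last first.
  by move=> n _ nK; rewrite dE// powR0// gt_eqF.
by rewrite dK -poweR_EFin -poweRrM mulfV ?gt_eqF// poweRe1 ?lee_fin ?normc_ge0.
Qed.

Lemma lnorm_lsc T (G : set_system T) p (f : T -> nat -> C) l (e : R) :
  ProperFilter G -> (1 <= p)%E ->
  (forall n, f t n @[t --> G] --> l n) ->
  (\forall t \near G, lnorm p (f t) <= e%:E)%E -> (lnorm p l <= e%:E)%E.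
Proof.
move=> PG p1 fl fe; apply: lnorm_trunc_sup => // K.
apply/lee_addgt0Pr => eps eps0.
have small : \forall t \near G, \sum_(n < K) normc ((l - f t) n) <= eps.
  elim: K eps eps0 => [|K IH] eps eps0.
    by apply: nearW => t; rewrite big_ord0 ltW.
  have eps2 : 0 < eps / 2 by rewrite divr_gt0.
  have := fl K => /cvgrPdist_le /(_ (eps / 2)%:C); rewrite ltcR => /(_ eps2) fK.
  near=> t; rewrite big_ord_recr/= [leRHS]splitr lerD//.
    by near: t; exact: IH.
  by rewrite -lecR -normrcE; near: t.
have [t [te tK]] := filter_ex (filterI fe small).
have -> : trunc K l = trunc K (f t) + trunc K (l - f t).
  apply/funext => n.
  suff : trunc K l n = trunc K (f t) n + trunc K (l - f t) n by [].
  rewrite /trunc; case: ifP => _; last by rewrite addr0.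
  suff : l n = f t n + (l n - f t n) by [].
  by rewrite addrC subrK.
apply: le_trans (lnormD _ _ p1) _; apply: leeD.
  apply: le_trans te; apply: ler_lnorm => // n.
  by rewrite /trunc; case: ifP => // _; rewrite normc0 normc_ge0.
by apply: le_trans (lnorm_trunc_le _ _ p1) _; rewrite lee_fin.
Unshelve. all: by end_near. Qed.

End LpNorm.

Section Completeness.
Context {R : realType}.
Local Notation C := R[i]^o.

Lemma complex_complete (F : set_system C) : ProperFilter F -> cauchy F -> cvg F.
Proof.
move=> PF /cauchyP cF.
have normc_lt (z : C) (e : R) : `|z| < e%:C -> normc z < e.
  by rewrite normrcE ltcR.
have part (f : C -> R) : (forall z w, `|f z - f w| <= normc (z - w)) ->
    cvg (f @ F).
  move=> fle; apply/cauchy_cvgP/cauchy_exP => e e0.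
  have [z Fz] := cF e%:C (etrans (ltcR _ _) e0).
  exists (f z); rewrite /fmap /=; apply: filterS Fz => w zw.
  exact: le_lt_trans (fle _ _) (normc_lt _ _ zw).
have /part cRe : forall z w : C, `|complex.Re z - complex.Re w| <= normc (z - w).
  move=> z w; have := normc_ge_Re (z - w); rewrite normrcE lecR.
  by case: z w => ? ? [? ?].
have /part cIm : forall z w : C, `|complex.Im z - complex.Im w| <= normc (z - w).
  move=> [a b] [c d] /=; rewrite -sqrtr_sqr ler_wsqrtr//.
  by rewrite lerDr sqr_ge0.
apply/cvg_ex; exists (lim (@complex.Re R @ F) +i* lim (@complex.Im R @ F)).
apply/cvgrPdist_lt => -[e e'] /andP[/eqP/= -> e0].
have e2 : 0 < e / 2 by rewrite divr_gt0.
near=> z; have -> : (e +i* 0) = (e / 2)%:C + (e / 2)%:C.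
  by rewrite -rmorphD -splitr.
apply: (@le_lt_trans _ _ (normc ((lim (@complex.Re R @ F) - complex.Re z)%:C) +
   normc ('i * (lim (@complex.Im R @ F) - complex.Im z)%:C))%:C).
  rewrite normrcE lecR (le_trans _ (le_normcD _ _))//.
  rewrite le_eqVlt; apply/orP; left; apply/eqP; congr normc.
  by move: (lim _) (lim _) => a b; clear; case: z => c d; simpc.
rewrite -rmorphD ltcR normcM /= !expr0n !expr1n /= !addr0 !add0r sqrtr1 mul1r.
rewrite !sqrtr_sqr ltrD//.
  by near: z; move/cvgrPdist_lt: cRe; apply.
by near: z; move/cvgrPdist_lt: cIm; apply.
Unshelve. all: by end_near. Qed.

Lemma lnorm_complete (V : normedModType R[i]) (v : V -> nat -> C) (p : \bar R) :
  (1 <= p)%E ->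
  (forall s t, v (s - t) = v s - v t) ->
  (forall s, (`|s|%R = (fine (lnorm p (v s)))%:C)) ->
  (forall s, lnorm p (v s) < +oo)%E ->
  (forall l, (forall e : R, 0 < e ->
     exists s, (lnorm p (v s - l)%R <= e%:E)%E) -> exists s, v s = l) ->
  forall F : set_system V, ProperFilter F -> cauchy F -> cvg F.
Proof.
move=> p1 vB vnorm vfin vclosed F PF /cauchyP cF.
have vfine s : (lnorm p (v s) = (fine (lnorm p (v s)))%:E)%E.
  by rewrite fineK// ge0_fin_numE ?lnorm_ge0.
have ball_lnorm s t (e : R) : ball s e%:C t -> (lnorm p (v s - v t)%R < e%:E)%E.
  rewrite -ball_normE /= vnorm ltcR vB => st.
  by rewrite -vB vfine lte_fin vB.
have cvF n : cvg (v s n @[s --> F]).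
  apply: complex_complete; apply/cauchyP => -[e e'] /andP[/eqP/= -> e0].
  have [s Fs] := cF e%:C (etrans (ltcR _ _) e0).
  exists (v s n); rewrite /fmap /=; apply: filterS Fs => t /ball_lnorm st.
  rewrite -ball_normE /= normrcE ltcR -lte_fin.
  exact: le_lt_trans (normc_le_lnorm (v s - v t) n p1) st.
pose l n : C := lim (v s n @[s --> F]).
have near_l (e : R) : 0 < e ->
    \forall s \near F, (lnorm p (v s - l)%R <= e%:E)%E.
  move=> e0; have e2 : 0 < e / 2 by rewrite divr_gt0.
  have [s0 Fs0] := cF (e / 2)%:C (etrans (ltcR _ _) e2).
  apply: filterS (Fs0) => s /ball_lnorm s0s.
  apply: (@lnorm_lsc _ _ F _ (fun t => v s - v t)) => //.
    by move=> n; apply: cvgB; [exact: cvg_cst|exact: cvF].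
  apply: filterS Fs0 => t /ball_lnorm s0t.
  have -> : v s - v t = (v s0 - v t) - (v s0 - v s).
    by rewrite opprB [RHS]addrC addrA subrK.
  apply: le_trans (lnormD _ _ p1) _; rewrite lnormN//.
  by rewrite (splitr e) EFinD leeD// ltW.
have [s vs] : exists s, v s = l.
  by apply: vclosed => e /near_l /filter_ex.
apply/cvg_ex; exists s; apply/cvgrPdist_le => -[e e'] /andP[/eqP/= -> e0].
apply: filterS (near_l _ e0) => t; rewrite -vs -lnormN// opprB -vB vfine lee_fin.
by rewrite vnorm lecR.
Qed.

End Completeness.

Section LpSpace.
Context {R : realType}.
Variables (p : \bar R) (p1 : (1 <= p)%E).
Local Notation C := R[i]^o.

Definition lp_pred (_ : (1 <= p)%E) : {pred nat -> C} :=
  [pred x | (lnorm p x < +oo)%E].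

Record lp_space := LpSpace {
  lp_val :> nat -> C;
  lp_valP : lp_val \in lp_pred p1 }.

HB.instance Definition _ := [isSub for lp_val].
HB.instance Definition _ := [Choice of lp_space by <:].

Lemma lp_submod_closed : submod_closed (lp_pred p1).
Proof.
split=> [|a x y]; rewrite !inE ?lnorm0// => x_fin y_fin.
apply: le_lt_trans (lnormD _ _ p1) _; rewrite lnormZ//.
by rewrite lte_add_pinfty// lte_mul_pinfty// lee_fin normc_ge0.
Qed.

HB.instance Definition _ := GRing.isSubmodClosed.Build R[i] (nat -> C)
  (lp_pred p1) lp_submod_closed.
HB.instance Definition _ := [SubChoice_isSubLmodule of lp_space by <:].

(* Norms of modules over R[i] take their values in R[i]. *)
Definition lp_norm (x : lp_space) : R[i] := (fine (lnorm p x))%:C.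

Lemma lp_lty (x : lp_space) : (lnorm p x < +oo)%E.
Proof. exact: lp_valP. Qed.

Lemma lp_fineK (x : lp_space) : ((fine (lnorm p x))%:E = lnorm p x)%E.
Proof. by rewrite fineK// ge0_fin_numE ?lnorm_ge0// lp_lty. Qed.

Lemma lp_normD x y : lp_norm (x + y) <= lp_norm x + lp_norm y.
Proof.
by rewrite /lp_norm -rmorphD lecR -lee_fin EFinD !lp_fineK lnormD.
Qed.

Lemma lp_normZ (a : R[i]) x : lp_norm (a *: x) = `|a| * lp_norm x.
Proof.
rewrite /lp_norm normrcE -rmorphM; congr _%:C.
by apply: EFin_inj; rewrite EFinM !lp_fineK lnormZ.
Qed.

Lemma lp_norm_eq0 x : lp_norm x = 0 -> x = 0.
Proof.
move=> [x0]; apply/val_inj/funext => n; apply/eq0_normc/eqP.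
rewrite eq_le normc_ge0 andbT -lee_fin.
by rewrite (le_trans (normc_le_lnorm _ n p1))// -lp_fineK x0.
Qed.

HB.instance Definition _ :=
  Lmodule_isNormed.Build R[i] lp_space lp_normD lp_normZ lp_norm_eq0.

Lemma lp_complete (F : set_system lp_space) :
  ProperFilter F -> cauchy F -> cvg F.
Proof.
apply: (@lnorm_complete R lp_space lp_val p) => // [x|l near_l].
  exact: lp_lty.
have [s sl] := near_l 1 ltr01.
have l_fin : l \in lp_pred p1.
  have -> : l = lp_val s - (lp_val s - l) by rewrite opprB addrC subrK.
  rewrite inE; apply: le_lt_trans (lnormD _ _ p1) _; rewrite lnormN//.
  by rewrite lte_add_pinfty ?lp_lty// (le_lt_trans sl)// ltry.
by exists (LpSpace l_fin).
Qed.

HB.instance Definition _ := Uniform_isComplete.Build lp_space lp_complete.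

End LpSpace.

Section C0Space.
Context (R : realType).
Local Notation C := R[i]^o.

Definition c0_pred : {pred nat -> C} :=
  [pred x : nat -> C | `[< x @ \oo --> (0 : C) >]].

Record c0_space := C0Space {
  c0_val :> nat -> C;
  c0_valP : c0_val \in c0_pred }.

HB.instance Definition _ := [isSub for c0_val].
HB.instance Definition _ := [Choice of c0_space by <:].

Lemma c0_submod_closed : submod_closed c0_pred.
Proof.
split=> [|a x y]; first by apply/asboolP; exact: cvg_cst.
move=> /asboolP x0 /asboolP y0; apply/asboolP.
have ax0 : (a : C) *: x n @[n --> \oo] --> (a : C) *: (0 : C).
  by apply: cvgZr.
have e0 : (a : C) *: (0 : C) + (0 : C) = 0 by rewrite addr0; exact: mulr0.
rewrite -e0; exact: (cvgD ax0 y0).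
Qed.

HB.instance Definition _ := GRing.isSubmodClosed.Build R[i] (nat -> C)
  c0_pred c0_submod_closed.
HB.instance Definition _ := [SubChoice_isSubLmodule of c0_space by <:].

Lemma c0_cvg (x : c0_space) : c0_val x @ \oo --> (0 : C).
Proof. by have /asboolP := c0_valP x. Qed.

Lemma c0_near (x : nat -> C) : x @ \oo --> (0 : C) <->
  forall e : R, 0 < e -> \forall n \near \oo, normc (x n) <= e.
Proof.
split=> [/cvgrPdist_le x0 e e0|x0].
  have := x0 e%:C; rewrite ltcR => /(_ e0); apply: filterS => n.
  by rewrite sub0r normrN normrcE lecR.
apply/cvgrPdist_le => -[e e'] /andP[/eqP/= -> e0].
by apply: filterS (x0 _ e0) => n; rewrite sub0r normrN normrcE lecR.
Qed.

Lemma c0_lty (x : c0_space) : (lnorm +oo x < +oo)%E.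
Proof.
have [N _ xN] := (c0_near x).1 (c0_cvg x) 1 ltr01.
apply: (@le_lt_trans _ _ (1 + \sum_(n < N) normc (x n))%:E); last exact: ltry.
apply: ge_ereal_sup => _ [n _ <-]; rewrite lee_fin.
have [nN|Nn] := ltnP n N.
  rewrite (bigD1 (Ordinal nN))//= addrCA lerDl addr_ge0// sumr_ge0// => i _.
  exact: normc_ge0.
rewrite (le_trans (xN n Nn))// lerDl sumr_ge0// => i _; exact: normc_ge0.
Qed.

Lemma c0_fineK (x : c0_space) : ((fine (lnorm +oo x))%:E = lnorm +oo x)%E.
Proof. by rewrite fineK// ge0_fin_numE ?lnorm_ge0// c0_lty. Qed.

Definition c0_norm (x : c0_space) : R[i] := (fine (lnorm +oo x))%:C.

Let p1 : (1 <= +oo :> \bar R)%E. Proof. exact: leey. Qed.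

Lemma c0_normD x y : c0_norm (x + y) <= c0_norm x + c0_norm y.
Proof.
by rewrite /c0_norm -rmorphD lecR -lee_fin EFinD !c0_fineK lnormD.
Qed.

Lemma c0_normZ (a : R[i]) x : c0_norm (a *: x) = `|a| * c0_norm x.
Proof.
rewrite /c0_norm normrcE -rmorphM; congr _%:C.
by apply: EFin_inj; rewrite EFinM !c0_fineK lnormZ.
Qed.

Lemma c0_norm_eq0 x : c0_norm x = 0 -> x = 0.
Proof.
move=> [x0]; apply/val_inj/funext => n; apply/eq0_normc/eqP.
rewrite eq_le normc_ge0 andbT -lee_fin.
by rewrite (le_trans (normc_le_lnorm _ n p1))// -c0_fineK x0.
Qed.

HB.instance Definition _ :=
  Lmodule_isNormed.Build R[i] c0_space c0_normD c0_normZ c0_norm_eq0.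

Lemma c0_complete (F : set_system c0_space) :
  ProperFilter F -> cauchy F -> cvg F.
Proof.
apply: (@lnorm_complete R c0_space c0_val +oo%E) => // [x|l near_l].
  exact: c0_lty.
suff l0 : l \in c0_pred by exists (C0Space l0).
apply/asboolP/c0_near => e e0; have e2 : 0 < e / 2 by rewrite divr_gt0.
have [s sl] := near_l _ e2.
apply: filterS ((c0_near s).1 (c0_cvg s) _ e2) => n sn.
have -> : l n = s n - (s n - l n) by rewrite opprB addrC subrK.
rewrite (splitr e) (le_trans (le_normcD _ _))// lerD// normcN -lee_fin.
exact: le_trans (normc_le_lnorm (c0_val s - l) n p1) sl.
Qed.

HB.instance Definition _ := Uniform_isComplete.Build c0_space c0_complete.

End C0Space.

(* [{linear _ -> _}] and multiplicativity do not assume psi 1 = 1, nor any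
   continuity of psi; the product of [bop] is composition. *)
Definition SHAI (R : realType) (X : completeNormedModType R[i]) : Prop :=
  forall Y : completeNormedModType R[i], (exists y : Y, y != 0) ->
  forall psi : {linear bop X -> bop Y}, {morph psi : S T / S * T} ->
  (forall T : bop Y, exists S : bop X, psi S = T) ->
  injective psi.

(* Main.v *)
Require Import Defs.
From HB Require Import structures.
From mathcomp Require Import all_boot all_order all_algebra complex.
From mathcomp Require Import all_classical all_reals all_analysis.
From mathcomp Require Import ring lra.

(** Let psi : B(X) -> B(Y) be onto and suppose that psi kills a nonzero operator.
    Its kernel is a two-sided ideal, so psi kills every operator of finite rank.  By
    the Hahn-Banach theorem B(Y) contains a rank-one idempotent q, for which
    q B(Y) q consists of the scalar multiples of q; write q = psi T.  The proof
    rests on a dichotomy for operators T on X: either the identity of X factors as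
    A T B, or T^2 is at distance less than 1 from the operators of finite rank.

    Both alternatives are absurd ([SHAI_dichotomy]).  In the second one, a Neumann
    series gives a right inverse of 1 - (T^2 - F) with F of finite rank; psi maps
    this operator to 1 - q, and q (1 - q) = 0 forces q = 0.  In the first one,
    1 = psi A q psi B, so every psi S acts on Y as a scalar; but X is isomorphic to
    its own square, which yields A1 B1 = 1 = A2 B2 and A1 B2 = 0, and scalars
    cannot satisfy these three equations.  Since the argument is algebraic modulo the
    finite-rank operators, no continuity of psi enters.

    For c_0 and l_p with p finite the dichotomy is a gliding hump
    ([factor_or_finrank_tails]).  If T stays large on all tails, there are blocks
    w_k, supported on successive intervals, whose images T w_k are concentrated on
    the same intervals up to summable errors, and functionals norming these images
    recover the coefficients of a sum of blocks.  To make the images vanish to the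
    left of the interval also when p = 1, where block sequences need not be weakly
    null, one takes differences of two blocks whose images nearly agree there.

    For l_oo ([factor_or_square_finrank]) each coordinate of T is a bounded
    functional on l_oo; its absolute value, a positive functional, gives a finitely
    additive measure on the subsets of nat.  If these measures do not tend to zero
    uniformly on some sequence of disjoint sets, Rosenthal's disjointification
    lemma makes the identity factor through T.  Otherwise finitely many of them
    control all of them uniformly ([uniform_control]), so T is small on every
    vector of the unit ball with small integral against one positive functional.
    Differences of vectors of the unit ball can be chosen nearly orthogonal for
    such a functional; then averages of the moduli of their images under T are
    uniformly small, and a second application of T makes one of them small in norm
    ([square_almost_repetition]).  Thus T^2 maps the unit ball to a totally bounded
    set, and sampling at finitely many coordinates approximates T^2 by an operator
    of finite rank. *)

Import Order.TTheory GRing.Theory Num.Theory.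
Import numFieldNormedType.Exports.
Local Open Scope classical_set_scope.
Local Open Scope ring_scope.
Local Open Scope complex_scope.

Set Implicit Arguments.
Unset Strict Implicit.
Unset Printing Implicit Defensive.

Local Notation normc := Normc.normc.

(** * Norms with real values *)

Section RealNorm.
Context {R : realType}.
Implicit Types z w : R[i].

Lemma normC z : `|z| = (normc z)%:C.
Proof. by case: z. Qed.

Lemma normc_rec (a : R) : normc (a%:C) = `|a|.
Proof. by rewrite /= expr0n addr0 sqrtr_sqr. Qed.

Lemma ler_normcD z w : normc (z + w) <= normc z + normc w.
Proof. by rewrite -lecR rmorphD/= -!normC ler_normD. Qed.

Lemma ler_normcB z w : normc (z - w) <= normc z + normc w.
Proof. by rewrite -lecR rmorphD/= -!normC ler_normB. Qed.

Lemma ler_normc_sum (I : Type) (r : seq I) (P : pred I) (F : I -> R[i]) :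
  normc (\sum_(i <- r | P i) F i) <= \sum_(i <- r | P i) normc (F i).
Proof.
by rewrite -lecR rmorph_sum/= -normC (le_trans (ler_norm_sum _ _ _)).
Qed.

Lemma ler_norm_Re z : `|complex.Re z| <= normc z.
Proof. by case: z => a b; rewrite /= -sqrtr_sqr ler_wsqrtr// lerDl sqr_ge0. Qed.

Lemma ler_norm_Im z : `|complex.Im z| <= normc z.
Proof. by case: z => a b; rewrite /= -sqrtr_sqr ler_wsqrtr// lerDr sqr_ge0. Qed.

Lemma ler_normc_ReIm z : normc z <= `|complex.Re z| + `|complex.Im z|.
Proof.
rewrite {1}[z]complexE (le_trans (ler_normcD _ _))// Normc.normcM !normc_rec.
by rewrite [normc 'i](_ : _ = 1) ?mul1r//= expr0n expr1n add0r sqrtr1.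
Qed.

Lemma normc_half_sub z w : normc z <= 1 -> normc w <= 1 ->
  normc ((1 / 2)%:C * (z - w)) <= 1.
Proof.
move=> z1 w1; rewrite Normc.normcM normc_rec ger0_norm//.
by have := ler_normcB z w; lra.
Qed.

Lemma ReB z w : complex.Re (z - w) = complex.Re z - complex.Re w.
Proof. by case: z w => a b []. Qed.

Lemma ImB z w : complex.Im (z - w) = complex.Im z - complex.Im w.
Proof. by case: z w => a b []. Qed.

Lemma phaseP z : exists2 w : R[i], normc w = 1 & w * z = (normc z)%:C.
Proof.
have [->|z0] := eqVneq z 0.
  by exists 1; rewrite ?Normc.normc1// mulr0 Normc.normc0.
have nz0 : normc z != 0 by apply: contra_neq z0 => /Normc.eq0_normc.
exists ((normc z)%:C / z); last by rewrite -mulrA mulVf// mulr1.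
by rewrite Normc.normcM Normc.normcV normc_rec ger0_norm ?normc_ge0// mulfV.
Qed.

Context {X : normedModType R[i]}.
Implicit Types x y : X.

(** The norm of a module over R[i] takes its values in R[i]. *)
Definition nrm x : R := complex.Re `|x|.

Lemma nrmE x : `|x| = (nrm x)%:C.
Proof. by rewrite /nrm; have := normr_ge0 x; case: `|x| => a b /andP[/eqP/= ->]. Qed.

Lemma nrm_ge0 x : 0 <= nrm x.
Proof. by rewrite -lecR -nrmE normr_ge0. Qed.

Lemma nrmD x y : nrm (x + y) <= nrm x + nrm y.
Proof. by rewrite -lecR rmorphD/= -!nrmE ler_normD. Qed.

Lemma nrmZ a x : nrm (a *: x) = normc a * nrm x.
Proof. by apply: (@complexI R); rewrite rmorphM/= -!nrmE -normC normrZ. Qed.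

Lemma nrm0 : nrm (0 : X) = 0.
Proof. by rewrite /nrm normr0. Qed.

Lemma nrm_eq0 x : nrm x = 0 -> x = 0.
Proof. by move=> x0; apply/eqP; rewrite -normr_eq0 nrmE x0. Qed.

Lemma nrm_gt0 x : x != 0 -> 0 < nrm x.
Proof. by move=> x0; rewrite lt_def nrm_ge0 andbT; apply: contra_neq x0 => /nrm_eq0. Qed.

Lemma nrmN x : nrm (- x) = nrm x.
Proof. by rewrite /nrm normrN. Qed.

Lemma nrmB x y : nrm (x - y) <= nrm x + nrm y.
Proof. by rewrite -(nrmN y) nrmD. Qed.

Lemma nrm_distC x y : nrm (x - y) = nrm (y - x).
Proof. by rewrite -nrmN opprB. Qed.

Lemma nrm_sum (I : Type) (r : seq I) (P : pred I) (F : I -> X) :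
  nrm (\sum_(i <- r | P i) F i) <= \sum_(i <- r | P i) nrm (F i).
Proof.
rewrite -lecR rmorph_sum/= -nrmE (le_trans (ler_norm_sum _ _ _))//.
by apply: ler_sum => i _; rewrite nrmE.
Qed.

Lemma bounded_operatorP (f : X -> X) c : linear f ->
  (forall x, nrm (f x) <= c * nrm x) -> f \in @bounded_operator _ X.
Proof.
move=> lf fc; apply/asboolP; split => //; exists c%:C => x.
by rewrite !nrmE -rmorphM lecR.
Qed.

(** A constant that works is real and can be taken positive, which allows dividing by it. *)
Lemma bop_nrm (T : bop X) : exists2 c, 0 < c & forall x, nrm (T x) <= c * nrm x.
Proof.
have [M TM] := bop_bounded T; exists (normc M + 1) => [|x].
  by rewrite ltr_wpDl ?normc_ge0.
have [->|x0] := eqVneq x 0; first by rewrite linear0 !nrm0 mulr0.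
apply: (@le_trans _ _ (normc M * nrm x)); last first.
  by rewrite ler_wpM2r ?nrm_ge0// lerDl.
rewrite -lecR rmorphM/= -!nrmE (le_trans (TM x))// ler_wpM2r//.
have Mge0 : 0 <= M by rewrite -(pmulr_lge0 _ (_ : 0 < `|x|)) ?normr_gt0// (le_trans _ (TM x)).
by rewrite -normC ger0_norm.
Qed.

End RealNorm.

(** * The Hahn-Banach theorem over the complex numbers *)

Section HahnBanach.
Context {R : realType} {V : normedModType R[i]}.
Implicit Types (x y u v : V) (G : set (V * R)).

(** Partial real functionals are represented by their graphs, so that a chain of
    extensions has its union as an upper bound. *)
Let partial_functional u G :=
  [/\ forall x y a b (s t : R), G (x, a) -> G (y, b) -> G (s%:C *: x + t%:C *: y, s * a + t * b),
      forall x a, G (x, a) -> a <= nrm x &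
      G !=set0 -> G (u, nrm u)].

Let extension G v (c : R) : set (V * R) :=
  [set z | exists x a t, G (x, a) /\ z = (x + t%:C *: v, a + t * c)].

(** The admissible values at v lie above all a - nrm (x - v) and below all
    nrm (y + v) - b, and the triangle inequality separates these two families. *)
Lemma ex_bop_extension_value u G v : G !=set0 -> partial_functional u G ->
  exists c, forall x a, G (x, a) -> a + c <= nrm (x + v) /\ a - c <= nrm (x - v).
Proof.
move=> G0 [Glin Gle _].
pose S := [set r | exists x a, G (x, a) /\ r = a - nrm (x - v)].
have key y b x a : G (y, b) -> G (x, a) -> a - nrm (x - v) <= nrm (y + v) - b.
  move=> Gy Gx; have := Gle _ _ (Glin _ _ _ _ 1 1 Gx Gy).
  rewrite !scale1r !mul1r => h; rewrite lerBlDr -addrA [- b + _]addrC addrA lerBrDr.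
  apply: le_trans h _; rewrite (_ : x + y = (y + v) + (x - v)); first exact: nrmD.
  by rewrite addrACA subrr addr0 addrC.
have [[x0 a0] G00] := G0.
have hS : has_sup S.
  split; first by exists (a0 - nrm (x0 - v)); exists x0, a0.
  by exists (nrm (x0 + v) - a0) => _ [x [a [Gx ->]]]; exact: key.
exists (sup S) => x a Gx; split.
  rewrite -lerBrDl; apply: ge_sup => [|_ [y [b [Gy ->]]]]; last exact: key.
  exact: hS.1.
by rewrite lerBlDr -lerBlDl; apply: ub_le_sup; [exact: hS.2|exists x, a].
Qed.

(** A maximal dominated graph is everywhere defined, since otherwise it could be
    extended to one more vector. *)
Lemma real_hahn_banach u : exists f : V -> R,
  [/\ forall x y, f (x + y) = f x + f y, forall (t : R) x, f (t%:C *: x) = t * f x,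
      forall x, f x <= nrm x & f u = nrm u].
Proof.
have [|A [PA Amax]] := @Zorn_bigcup _ (partial_functional u).
  move=> F FP tot; split.
  - move=> x y a b s t [X FX Xx] [Y FY Yy].
    have [XY|YX] := tot _ _ FX FY.
      by exists Y => //; have [l _ _] := FP _ FY; apply: l => //; exact: XY.
    by exists X => //; have [l _ _] := FP _ FX; apply: l => //; exact: YX.
  - by move=> x a [X /FP[_ l _]]; exact: l.
  - by move=> [z [X FX Xz]]; exists X => //; have [_ _] := FP _ FX; apply; exists z.
have A0 : A !=set0.
  apply/set0P/negP => /eqP A0.
  apply: (Amax [set z | exists t : R, z = (t%:C *: u, t * nrm u)]).
    rewrite A0; rewrite properEneq; split; last exact: sub0set.
    by rewrite eq_sym; apply/set0P; exists (1%:C *: u, 1 * nrm u), 1.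
  split.
  - move=> _ _ _ _ s t [r1 [-> ->]] [r2 [-> ->]]; exists (s * r1 + t * r2).
    by rewrite !scalerA -!rmorphM/= -scalerDl -rmorphD !mulrA -mulrDl.
  - move=> _ _ [t [-> ->]]; rewrite nrmZ normc_rec ler_wpM2r ?nrm_ge0//.
    exact: ler_norm.
  - by move=> _; exists 1; rewrite scale1r mul1r.
have [Alin Ale Au] := PA.
have Atot v : exists a, A (v, a).
  apply: contrapT => Av.
  have [c Ac] := ex_bop_extension_value v A0 PA.
  have A00 : A (0, 0).
    have [[x a] Ax] := A0.
    by have := Alin _ _ _ _ 0 0 Ax Ax; rewrite !scale0r !mul0r !addr0.
  apply: (Amax (extension A v c)).
    rewrite properEneq; split; last first.
      by move=> [x a] Ax; exists x, a, 0; rewrite scale0r mul0r !addr0.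
    apply/eqP => AE; apply: Av; exists c; rewrite AE; exists 0, 0, 1.
    by rewrite scale1r mul1r !add0r.
  split.
  - move=> _ _ _ _ s t [x [a [r [Ax [-> ->]]]]] [y [b [r' [Ay [-> ->]]]]].
    exists (s%:C *: x + t%:C *: y), (s * a + t * b), (s * r + t * r'); split; first exact: Alin.
    congr (_, _); last by ring.
    by rewrite !scalerDr !scalerA addrACA rmorphD !rmorphM scalerDl.
  - move=> _ _ [x [a [t [Ax [-> ->]]]]].
    have scale (s : R) : A (s%:C *: x, s * a).
      by have := Alin _ _ _ _ s 0 Ax Ax; rewrite scale0r mul0r !addr0.
    have [t0|t0|->] := ltgtP t 0.
    + have [_ h] := Ac _ _ (scale (- t)^-1).
      have : - t * ((- t)^-1 * a - c) <= - t * nrm ((- t)^-1%:C *: x - v).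
        by rewrite ler_pM2l// oppr_gt0.
      rewrite mulrBr mulrA mulfV ?oppr_eq0 ?lt_eqF// mul1r [- t * c]mulNr opprK => h2.
      apply: le_trans h2 _; rewrite le_eqVlt; apply/orP; left; apply/eqP.
      have -> : x + t%:C *: v = (- t)%:C *: ((- t)^-1%:C *: x - v).
        rewrite scalerBr scalerA -rmorphM mulfV ?oppr_eq0 ?lt_eqF// scale1r.
        by rewrite (rmorphN (@real_complex R)) scaleNr opprK.
      by rewrite nrmZ normc_rec gtr0_norm ?oppr_gt0.
    + have [h _] := Ac _ _ (scale t^-1).
      have : t * (t^-1 * a + c) <= t * nrm (t^-1%:C *: x + v) by rewrite ler_pM2l.
      rewrite mulrDr mulrA mulfV ?gt_eqF// mul1r => h2.
      apply: le_trans h2 _; rewrite le_eqVlt; apply/orP; left; apply/eqP.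
      have -> : x + t%:C *: v = t%:C *: (t^-1%:C *: x + v).
        by rewrite scalerDr scalerA -rmorphM mulfV ?gt_eqF// scale1r.
      by rewrite nrmZ normc_rec gtr0_norm.
    + by rewrite scale0r mul0r !addr0; exact: Ale.
  - by move=> _; exists u, (nrm u), 0; rewrite scale0r mul0r !addr0; split => //; exact: Au.
have [f fA] := choice Atot.
have Auniq x a b : A (x, a) -> A (x, b) -> a = b.
  move=> Aa Ab; have h s t : s * a + t * b <= nrm (s%:C *: x + t%:C *: x).
    by apply: Ale; exact: Alin.
  apply/eqP; rewrite eq_le; apply/andP; split.
    have := h 1 (-1); rewrite rmorphN scaleNr subrr nrm0; lra.
  have := h (-1) 1; rewrite rmorphN scaleNr addNr nrm0; lra.
exists f; split.
- move=> x y; apply: Auniq (fA _) _.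
  by have := Alin _ _ _ _ 1 1 (fA x) (fA y); rewrite !scale1r !mul1r.
- move=> t x; apply: Auniq (fA _) _.
  by have := Alin _ _ _ _ t 0 (fA x) (fA x); rewrite scale0r mul0r !addr0.
- by move=> x; exact: Ale (fA x).
- by apply: Auniq (fA _) (Au A0).
Qed.

(** The complex functional is x |-> g x - i g (i x), where g is a real one; rotating x
    so that its value becomes real transfers the bound. *)
Lemma hahn_banach u : u != 0 -> exists f : V -> R[i],
  [/\ forall a x y, f (a *: x + y) = a * f x + f y,
      forall x, normc (f x) <= nrm x / nrm u & f u = 1].
Proof.
move=> u0; have [g [gD gZ gle gu]] := real_hahn_banach u.
pose F x : R[i] := g x +i* (- g ('i *: x)).
have gN x : g (- x) = - g x by have := gZ (-1) x; rewrite rmorphN scaleN1r mulN1r.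
have FD x y : F (x + y) = F x + F y.
  by rewrite /F scalerDr !gD opprD.
have FZr (t : R) x : F (t%:C *: x) = t%:C * F x.
  by rewrite /F scalerA mulrC -scalerA !gZ -mulrN; simpc.
have Fi x : F ('i *: x) = 'i * F x.
  by rewrite /F scalerA -expr2 sqr_i scaleN1r gN opprK; simpc.
have FZ a x : F (a *: x) = a * F x.
  by rewrite [a]complexE scalerDl mulrDl FD FZr -scalerA Fi FZr mulrA.
have Fle x : normc (F x) <= nrm x.
  have [w w1 wF] := phaseP (F x).
  have := gle (w *: x); rewrite nrmZ w1 mul1r; apply: le_trans.
  have -> : g (w *: x) = complex.Re (F (w *: x)) by [].
  by rewrite FZ wF.
have Fu : F u = (nrm u)%:C.
  have := Fle u; rewrite /F gu /= => h.
  have nu0 := nrm_ge0 u.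
  have : Num.sqrt (nrm u ^+ 2 + (- g ('i *: u)) ^+ 2) ^+ 2 <= nrm u ^+ 2.
    by rewrite ler_sqr ?nnegrE// sqrtr_ge0.
  rewrite sqr_sqrtr ?addr_ge0 ?sqr_ge0// gerDl => h2.
  have /eqP : (- g ('i *: u)) ^+ 2 = 0 by apply/eqP; rewrite eq_le h2 sqr_ge0.
  by rewrite sqrf_eq0 => /eqP ->.
have nu0 := nrm_gt0 u0.
exists (fun x => F x / (nrm u)%:C); split.
- by move=> a x y; rewrite FD FZ mulrDl mulrA.
- move=> x; rewrite Normc.normcM Normc.normcV normc_rec gtr0_norm//.
  by rewrite ler_pM2r ?invr_gt0.
- by rewrite Fu mulfV// eq_complex /= gt_eqF.
Qed.

End HahnBanach.

(** * Right inverses by Neumann series *)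

Section Neumann.
Context {R : realType} {X : completeNormedModType R[i]}.

Lemma bopBE (S T : bop X) x : (S - T) x = S x - T x. Proof. by []. Qed.
Lemma bopME (S T : bop X) x : (S * T) x = S (T x). Proof. by []. Qed.

Lemma bop_scale (T : bop X) a x : T (a *: x) = a *: T x. Proof. exact: linearZZ. Qed.
Lemma bop_add (T : bop X) x y : T (x + y) = T x + T y. Proof. exact: linearD. Qed.
Lemma bop_sub (T : bop X) x y : T (x - y) = T x - T y. Proof. exact: linearB. Qed.
Lemma bop_zero (T : bop X) : T 0 = 0. Proof. exact: linear0. Qed.

(** The solution is the limit of the partial sums of the iterates of G at x. *)
Lemma neumann_fixpoint (G : bop X) (c : R) : 0 <= c < 1 ->
  (forall x, nrm (G x) <= c * nrm x) -> forall x, exists y, y = x + G y.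
Proof.
move=> /andP[c0 c1] Gc x; have c1' : 0 < 1 - c by lra.
pose u k := iter k G x.
have uc k : nrm (u k) <= c ^+ k * nrm x.
  elim: k => [|k IH]; first by rewrite expr0 mul1r.
  by rewrite (le_trans (Gc _))// exprS -mulrA ler_wpM2l.
have sum_c m n : \sum_(m <= k < n) c ^+ k <= c ^+ m / (1 - c).
  have [nm|/ltnW mn] := leqP n m.
    rewrite big_geq// divr_ge0//; [exact: exprn_ge0|exact: ltW].
  rewrite ler_pdivlMr// -(subnKC mn) mulrC.
  elim: (n - m)%N => [|k IH]; first by rewrite addn0 big_geq// mulr0 exprn_ge0.
  rewrite addnS big_nat_recr ?leq_addr//= mulrDr.
  have -> : (1 - c) * \sum_(m <= i < m + k) c ^+ i = c ^+ m - c ^+ (m + k).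
    clear IH; elim: k => [|k IH]; first by rewrite addn0 big_geq// mulr0 subrr.
    by rewrite addnS big_nat_recr ?leq_addr//= mulrDr IH exprS; ring.
  rewrite mulrBl mul1r -exprS addrA subrK lerBlDr lerDl; exact: exprn_ge0.
have ccvg : (c ^+ m / (1 - c) * nrm x) @[m --> \oo] --> (0 : R).
  rewrite -(mul0r (nrm x)) -[X in X * nrm x](mul0r (1 - c)^-1).
  apply: cvgM; last exact: cvg_cst.
  by apply: cvgM; [apply: cvg_expr; rewrite ger0_norm|exact: cvg_cst].
have /cauchy_cvgP/cvg_ex[y uy] : cauchy (series u @ \oo).
  apply/cauchy_seriesP => -[e e'] /andP[/eqP/= -> e0].
  have := ccvg => /cvgrPdist_lt /(_ e e0) [N _ HN].
  exists ([set n | (N <= n)%N], setT) => /=; first by split; [exists N|exact: filterT].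
  move=> [m n] /= [/HN /= h _].
  rewrite nrmE ltcR; apply: le_lt_trans (nrm_sum _ _ _) _.
  apply: (@le_lt_trans _ _ (c ^+ m / (1 - c) * nrm x)).
    rewrite (le_trans (ler_sum _ (fun k _ => uc k)))// -mulr_suml ler_wpM2r//.
    exact: nrm_ge0.
  by move: h; rewrite sub0r normrN; apply: le_lt_trans; exact: ler_norm.
exists y; apply/eqP; rewrite -subr_eq0; apply/eqP/nrm_eq0/eqP.
rewrite eq_le nrm_ge0 andbT; apply/ler_addgt0Pr => e e0; rewrite add0r.
have e2 : 0 < e / 2 by lra.
move: uy => /cvgrPdist_le /(_ (e / 2)%:C); rewrite ltcR => /(_ e2) [N _ HN].
have h1 := HN N.+1 (leqnSn N); have h2 := HN N (leqnn N).
rewrite /= nrmE lecR in h1; rewrite /= nrmE lecR in h2.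
have sS : series u N.+1 = x + G (series u N).
  rewrite /series/= big_nat_recl//= linear_sum/=; congr (_ + _).
have -> : y - (x + G y) = (y - series u N.+1) + G (series u N - y).
  by rewrite sS [G (_ - y)]linearB/= !opprD !addrA subrK.
apply: le_trans (nrmD _ _) _; rewrite (splitr e) lerD//.
apply: le_trans (Gc _) _; rewrite nrm_distC.
by apply: le_trans h2; apply: ler_piMl; [exact: nrm_ge0|exact: ltW].
Qed.

(** Only a right inverse is produced: it is the solution operator of y = x + G y, and
    uniqueness of the solution makes it linear. *)
Lemma neumann (G : bop X) (c : R) : c < 1 ->
  (forall x, nrm (G x) <= c * nrm x) -> exists S, (1 - G) * S = 1.
Proof.
move=> c1 Gc.
have [x0|nx] := pselect (forall x : X, x = 0).
  by exists 0; apply/bopP => x; rewrite [LHS]x0 [RHS]x0.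
have c0 : 0 <= c.
  have /existsNP[x /eqP x0] := nx.
  by rewrite -(pmulr_lge0 _ (nrm_gt0 x0)) (le_trans (nrm_ge0 _) (Gc x)).
have c01 : 0 <= c < 1 by rewrite c0.
have [S SG] := choice (neumann_fixpoint c01 Gc).
have uniq x y y' : y = x + G y -> y' = x + G y' -> y = y'.
  move=> Ey Ey'; apply/eqP; rewrite -subr_eq0; apply/eqP/nrm_eq0/eqP.
  have : nrm (y - y') <= c * nrm (y - y').
    rewrite (le_trans _ (Gc _))// {1}Ey {1}Ey' [G (y - y')]linearB/=.
    by rewrite opprD addrACA subrr add0r.
  rewrite eq_le nrm_ge0 andbT -subr_le0 -{1}[nrm _]mul1r -mulrBl.
  by rewrite pmulr_rle0// subr_gt0.
have Slin : linear S.
  move=> a x y; apply: (uniq (a *: x + y)); first exact: SG.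
  by rewrite {1}(SG x) {1}(SG y) linearP scalerDr addrACA.
have Sc x : nrm (S x) <= (1 - c)^-1 * nrm x.
  rewrite mulrC ler_pdivlMr ?subr_gt0// mulrBr mulr1 lerBlDr.
  by rewrite {1}SG (le_trans (nrmD _ _))// lerD2l mulrC.
exists (Bop (bounded_operatorP Slin Sc)); apply/bopP => x.
have -> : ((1 - G) * Bop (bounded_operatorP Slin Sc)) x = S x - G (S x) by [].
by rewrite {1}SG addrK.
Qed.

End Neumann.

(** * An algebraic criterion for the SHAI property *)

Section FiniteRank.
Context {R : realType} {X : normedModType R[i]}.

Lemma bop_sumE (I : Type) (r : seq I) (P : pred I) (F : I -> bop X) x :
  (\sum_(i <- r | P i) F i) x = \sum_(i <- r | P i) F i x.
Proof. by elim/big_rec2: _ => // i y S _ <-. Qed.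

Lemma bop_sum (I : Type) (r : seq I) (P : pred I) (T : bop X) (F : I -> X) :
  T (\sum_(i <- r | P i) F i) = \sum_(i <- r | P i) T (F i).
Proof. exact: linear_sum. Qed.

(** Only coordinate functionals occur, so that an ideal of operators contains all these
    sums as soon as it contains the operators u |-> e_m(u) x. *)
Definition finrank (e : nat -> X -> R[i]) (F : bop X) :=
  exists l : seq (nat * X * bop X),
    forall u, F u = \sum_(s <- l) e s.1.1 (s.2 u) *: s.1.2.

Lemma finrankD e F G : finrank e F -> finrank e G -> finrank e (F + G).
Proof.
by move=> [l Fl] [k Gk]; exists (l ++ k) => u; rewrite big_cat -Fl -Gk.
Qed.

End FiniteRank.

Section Criterion.
Context {R : realType} {X : completeNormedModType R[i]}.
Variable e : nat -> X -> R[i].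
Hypothesis e_linear : forall m a x y, e m (a *: x + y) = a * e m x + e m y.
Hypothesis e_le : forall m x, normc (e m x) <= nrm x.
Hypothesis e_sep : forall x, (forall m, e m x = 0) -> x = 0.

Lemma rank1_subproof m (x : X) : (fun u => e m u *: x) \in @bounded_operator _ X.
Proof.
apply: (@bounded_operatorP _ _ _ (nrm x)) => [a u v|u].
  by rewrite e_linear scalerDl scalerA.
by rewrite nrmZ mulrC ler_wpM2l ?nrm_ge0.
Qed.

Definition rank1 m x : bop X := Bop (rank1_subproof m x).

Lemma finrankE F : finrank e F -> exists l : seq (nat * X * bop X),
  F = \sum_(s <- l) rank1 s.1.1 s.1.2 * s.2.
Proof. by move=> [l Fl]; exists l; apply/bopP => x; rewrite Fl bop_sumE. Qed.

(** Sandwiching a nonzero D between two rank-one operators reproduces all of them, so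
    a nonzero ideal contains them. *)
Lemma rank1_nonzero_ideal (D : bop X) m z : D != 0 ->
  exists n x c, rank1 m z = c *: (rank1 n z * D * rank1 m x).
Proof.
move=> D0.
have [x /eqP Dx0] : exists x, D x <> 0.
  by apply/existsNP => D00; move/eqP: D0; apply; apply/bopP.
have [n enx] : exists n, e n (D x) <> 0.
  by apply/existsNP => en0; move/eqP: Dx0; apply; exact: e_sep.
exists n, x, (e n (D x))^-1; apply/bopP => u.
have -> : ((e n (D x))^-1 *: (rank1 n z * D * rank1 m x)) u =
  (e n (D x))^-1 *: (e n (D (e m u *: x)) *: z) by [].
rewrite bop_scale -[e m u *: D x]addr0 e_linear.
have -> : e n 0 = 0 by have := e_linear n (-1) 0 0; rewrite scaleN1r oppr0 addr0 mulN1r addNr.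
by rewrite addr0 scalerA mulrCA mulVf ?mulr1//; exact/eqP.
Qed.

(** The idempotent q below has rank one, so that q V q is always a multiple of q; this
    makes both alternatives of the dichotomy contradictory. *)
Lemma SHAI_dichotomy :
  (exists A1 B1 A2 B2 : bop X, [/\ A1 * B1 = 1, A2 * B2 = 1 & A1 * B2 = 0]) ->
  (forall T : bop X, (exists A B, A * T * B = 1) \/
    (exists F c, [/\ finrank e F, c < 1 & forall x, nrm ((T * T - F) x) <= c * nrm x])) ->
  SHAI X.
Proof.
move=> [A1 [B1 [A2 [B2 [AB1 AB2 AB12]]]]] dich Y [y0 y00] psi psiM psi_onto S S' SS'.
apply/eqP; rewrite -subr_eq0; apply/negPn/negP => D0.
set D := S - S' in D0; have psiD : psi D = 0 by rewrite linearB SS' subrr.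
have psi_rank1 m z : psi (rank1 m z) = 0.
  have [n [x [c ->]]] := rank1_nonzero_ideal m z D0.
  by rewrite linearZ/= !psiM psiD mulr0 mul0r scaler0.
have psi_fin F : finrank e F -> psi F = 0.
  by move=> /finrankE[l ->]; rewrite linear_sum big1// => s _; rewrite psiM psi_rank1 mul0r.
have psi1 : psi 1 = 1.
  by have [J psiJ] := psi_onto 1; rewrite -[LHS]mulr1 -psiJ -psiM mul1r.
have [f [flin fle fy0]] := hahn_banach y00.
have q_bounded : (fun y => f y *: y0) \in @bounded_operator _ Y.
  apply: (@bounded_operatorP _ _ _ 1) => [a u v|u].
    by rewrite flin scalerDl scalerA.
  by rewrite nrmZ -ler_pdivlMr ?nrm_gt0// mul1r.
pose q : bop Y := Bop q_bounded.
have q0 : q y0 <> 0 by rewrite /q/= fy0 scale1r; exact/eqP.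
have qVq V : q * V * q = f (V y0) *: q.
  apply/bopP => y; have -> : (q * V * q) y = f (V (f y *: y0)) *: y0 by [].
  rewrite bop_scale -[_ *: V y0]addr0 flin.
  have -> : f 0 = 0 by have := flin (-1) 0 0; rewrite scaleN1r oppr0 addr0 mulN1r addNr.
  by rewrite addr0 mulrC -scalerA.
have qq : q * q = q by rewrite -{1}[q]mulr1 qVq/= fy0 scale1r.
have [T psiT] := psi_onto q.
have [[A [B ATB]]|[F [c [finF c1 TF]]]] := dich T; last first.
  have [W GW] := neumann c1 TF.
  have W1 : (1 - q) * psi W = 1.
    transitivity (psi ((1 - (T * T - F)) * W)); last by rewrite GW.
    by rewrite psiM linearB/= [psi (_ - F)]linearB/= psiM psiT qq psi1 (psi_fin _ finF) subr0.
  have qW : q * ((1 - q) * psi W) = 0 by rewrite mulrA mulrBr mulr1 qq subrr mul0r.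
  have q00 : q = 0 by rewrite -qW W1 mulr1.
  by apply: q0; rewrite q00.
(* Inserting 1 = psi A * q * psi B on both sides of psi V compresses it by q. *)
have scalar V : exists c : R[i], psi V y0 = c *: y0.
  exists (f ((psi B * psi V * psi A) y0)).
  have E : psi A * q * psi B = 1 by rewrite -psiT -!psiM ATB psi1.
  transitivity ((1 * psi V * 1 : bop Y) y0); first by rewrite mul1r mulr1.
  rewrite -E.
  have -> : psi A * q * psi B * psi V * (psi A * q * psi B) =
    psi A * (q * (psi B * psi V * psi A) * q) * psi B by rewrite !mulrA.
  by rewrite qVq -bop_scalerAr -bop_scalerAl E.
have [a1 Ea1] := scalar A1; have [b1 Eb1] := scalar B1.
have [a2 Ea2] := scalar A2; have [b2 Eb2] := scalar B2.
have ev S1 S2 a b : psi S1 y0 = a *: y0 -> psi S2 y0 = b *: y0 ->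
    psi (S1 * S2) y0 = (a * b) *: y0.
  by move=> E1 E2; rewrite psiM bopME E2 bop_scale E1 scalerA mulrC.
have y0_inj (a b : R[i]) : a *: y0 = b *: y0 -> a = b.
  move=> /eqP; rewrite -subr_eq0 -scalerBl scaler_eq0 (negbTE y00) orbF subr_eq0.
  by move/eqP.
have ab1 : a1 * b1 = 1.
  by apply: y0_inj; rewrite -(ev _ _ _ _ Ea1 Eb1) AB1 psi1 scale1r.
have ab2 : a2 * b2 = 1.
  by apply: y0_inj; rewrite -(ev _ _ _ _ Ea2 Eb2) AB2 psi1 scale1r.
have ab12 : a1 * b2 = 0.
  by apply: y0_inj; rewrite -(ev _ _ _ _ Ea1 Eb2) AB12 linear0 scale0r.
have /eqP := ab12; rewrite mulf_eq0 => /orP[] /eqP z.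
  by move: ab1; rewrite z mul0r => /eqP; rewrite eq_sym oner_eq0.
by move: ab2; rewrite z mulr0 => /eqP; rewrite eq_sym oner_eq0.
Qed.

End Criterion.

(** * Block decompositions of the sequence norms *)

Section Blocks.
Context {R : realType}.
Implicit Types (f g a : nat -> R[i]) (p : \bar R).

Definition blk (kap : nat -> nat) k f : nat -> R[i] :=
  fun n => if kap n == k then f n else 0.

Definition tail N f : nat -> R[i] := fun n => if (n < N)%N then 0 else f n.

Lemma lnorm_fin_le r f (c : R) : 0 < r -> 0 <= c -> (lnorm r%:E f <= c%:E)%E =
  (\sum_(n <oo) (normc (f n) `^ r)%:E <= (c `^ r)%:E)%E.
Proof.
move=> r0 c0; have cE : (c%:E = (c `^ r)%:E `^ r^-1)%E.
  by rewrite poweR_EFin -powRrM mulfV ?gt_eqF// powRr1.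
apply/idP/idP => h.
  have -> : (\sum_(n <oo) (normc (f n) `^ r)%:E = lnorm r%:E f `^ r)%E.
    by rewrite /= -poweRrM mulVf ?gt_eqF// poweRe1 ?lsum_ge0.
  by rewrite -poweR_EFin lee_poweR ?lnorm_ge0 ?(ltW r0).
by rewrite cE /lnorm lee_poweR ?lsum_ge0 ?invr_ge0 ?(ltW r0).
Qed.

Lemma lnorm_fin_ge r f (c : R) : 0 < r -> 0 <= c -> (c%:E <= lnorm r%:E f)%E =
  ((c `^ r)%:E <= \sum_(n <oo) (normc (f n) `^ r)%:E)%E.
Proof.
move=> r0 c0; have cE : (c%:E = (c `^ r)%:E `^ r^-1)%E.
  by rewrite poweR_EFin -powRrM mulfV ?gt_eqF// powRr1.
apply/idP/idP => h.
  have -> : (\sum_(n <oo) (normc (f n) `^ r)%:E = lnorm r%:E f `^ r)%E.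
    by rewrite /= -poweRrM mulVf ?gt_eqF// poweRe1 ?lsum_ge0.
  by rewrite -poweR_EFin lee_poweR ?lee_fin ?(ltW r0).
by rewrite cE /lnorm lee_poweR ?invr_ge0 ?(ltW r0)// lee_fin powR_ge0.
Qed.

(** Interchange of two sums of nonnegative terms; each n lies in exactly one block. *)
Lemma blk_sum kap r f : 0 < r ->
  (\sum_(n <oo) (normc (f n) `^ r)%:E =
   \sum_(k <oo) \sum_(n <oo) (normc (blk kap k f n) `^ r)%:E)%E.
Proof.
move=> r0; rewrite nneseries_interchange; last by move=> *; rewrite lee_fin powR_ge0.
apply: eq_eseriesr => n _.
rewrite (@nneseriesD1 _ _ (kap n))//; last by move=> *; rewrite lee_fin powR_ge0.
rewrite /blk eqxx eseries0 ?adde0// => k _ /=.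
by rewrite eq_sym => /negbTE ->; rewrite Normc.normc0 powR0 ?gt_eqF.
Qed.

(** The norm of f is the norm of the sequence of the norms of its blocks; this lemma
    and the next one are the two inequalities that result. *)
Lemma lnorm_blk_le kap p f a : (1 <= p)%E ->
  (forall k, lnorm p (blk kap k f) <= (normc (a k))%:E)%E -> (lnorm p f <= lnorm p a)%E.
Proof.
case: p => [r||//] p1 fa; last first.
  apply: ge_ereal_sup => _ [n _ <-].
  apply: le_trans (normc_le_lnorm _ (kap n) p1).
  apply: le_trans (fa (kap n)).
  by rewrite -[f n](_ : blk kap (kap n) f n = _) ?normc_le_lnorm// /blk eqxx.
have r0 : 0 < r by rewrite (lt_le_trans ltr01).
rewrite /= lee_poweR ?lsum_ge0 ?invr_ge0 ?(ltW r0)// (blk_sum kap f)//.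
apply: lee_nneseries => k *; [exact: lsum_ge0|].
by rewrite -lnorm_fin_le ?normc_ge0.
Qed.

Lemma lnorm_blk_ge kap p f a : (1 <= p)%E ->
  (forall k, (normc (a k))%:E <= lnorm p (blk kap k f))%E -> (lnorm p a <= lnorm p f)%E.
Proof.
case: p => [r||//] p1 fa; last first.
  apply: ge_ereal_sup => _ [k _ <-]; apply: le_trans (fa k) _.
  apply: ler_lnorm => // n; rewrite /blk; case: ifP => //.
  by rewrite Normc.normc0 normc_ge0.
have r0 : 0 < r by rewrite (lt_le_trans ltr01).
rewrite /= lee_poweR ?lsum_ge0 ?invr_ge0 ?(ltW r0)// (blk_sum kap f)//.
apply: lee_nneseries => k *; [by rewrite lee_fin powR_ge0|].
by rewrite -lnorm_fin_ge ?normc_ge0.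
Qed.

Lemma lnorm_support p f N : (1 <= p)%E -> (forall n, (N <= n)%N -> f n = 0) ->
  (lnorm p f <= (\sum_(n < N) normc (f n))%:E)%E.
Proof.
move=> p1 f0; rewrite (_ : f = trunc N f) ?lnorm_trunc_le//.
  apply: le_trans (lnorm_trunc_le _ _ p1) _; rewrite lee_fin ler_sum// => n _.
  by rewrite /trunc ltn_ord.
by apply/funext => n; rewrite /trunc; case: ltnP => // /f0.
Qed.

Lemma lnorm_tail_cvg r f : 1 <= r -> (lnorm r%:E f < +oo)%E ->
  forall e : R, 0 < e -> exists N, (lnorm r%:E (tail N f) <= e%:E)%E.
Proof.
move=> r1 ffin e e0; have r0 : 0 < r by rewrite (lt_le_trans ltr01).
pose u n := (normc (f n) `^ r)%:E.
have ufin : (\sum_(n <oo) u n < +oo)%E.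
  by move: ffin => /lty_poweRy; apply; rewrite invr_eq0 gt_eqF.
have := @nneseries_tail_cvg _ u xpredT ufin (fun k _ => epowR_ge0 _ _).
move/fine_cvgP => [ufn /cvgrPdist_le /(_ (e `^ r))].
rewrite powR_gt0// => /(_ isT) ule.
have [N _ HN] := filterI ufn ule; exists N.
rewrite lnorm_fin_le ?(ltW e0)//; have [h1 h2] := HN N (leqnn N).
have -> : (\sum_(n <oo) (normc (tail N f n) `^ r)%:E = \sum_(N <= n <oo) u n)%E.
  rewrite [RHS]eseries_cond [RHS]eseries_mkcond; apply: eq_eseriesr => i _.
  by rewrite /tail ltnNge andTb; case: leqP => // _; rewrite Normc.normc0 powR0 ?gt_eqF.
rewrite -(fineK h1) lee_fin; apply: le_trans h2.
by rewrite sub0r normrN ler_norm.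
Qed.

End Blocks.

(** * A common model of the sequence spaces *)

Section SequenceModel.
Context {R : realType}.
Implicit Types (f g a : nat -> R[i]).

Definition vanishing_tails (p : \bar R) f :=
  forall e : R, 0 < e -> exists N, (lnorm p (tail N f) <= e%:E)%E.

(** A Banach space that v identifies with the sequences of finite p-norm, among which
    only those with vanishing tails are kept if b holds.  With b true this covers c_0
    (for p infinite) and l_p for p finite; l_oo is the case where b is false. *)
Record seq_model (p : \bar R) (b : Prop) (X : completeNormedModType R[i])
    (v : X -> nat -> R[i]) : Prop := SeqModel {
  sm_linear : forall (a : R[i]) (x y : X) n, v (a *: x + y) n = a * v x n + v y n;
  sm_norm : forall x, lnorm p (v x) = (nrm x)%:E;
  sm_tails : b -> forall x, vanishing_tails p (v x);
  sm_onto : forall f, (lnorm p f < +oo)%E -> (b -> vanishing_tails p f) ->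
    exists x, v x = f }.

Lemma lnormZ_fun p (c : R[i]) f : (1 <= p)%E ->
  lnorm p (fun n => (c * f n)%R) = ((normc c)%:E * lnorm p f)%E.
Proof. exact: lnormZ. Qed.

Lemma galois_unbounded (kap M : nat -> nat) :
  (forall n K, (kap n < K)%N = (n < M K)%N) -> forall N, exists K, (N <= M K)%N.
Proof.
move=> gal [|n]; first by exists 0%N.
by exists (kap n).+1; rewrite -gal.
Qed.

Context {p : \bar R} {b : Prop} {X : completeNormedModType R[i]} {v : X -> nat -> R[i]}.
Hypothesis p1 : (1 <= p)%E.
Hypothesis mod_v : seq_model p b v.

Lemma sm_zero n : v 0 n = 0.
Proof. by have := sm_linear mod_v (-1) 0 0 n; rewrite scaleN1r oppr0 addr0 mulN1r addNr. Qed.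

Lemma sm_add x y n : v (x + y) n = v x n + v y n.
Proof. by rewrite -[x]scale1r (sm_linear mod_v) mul1r scale1r. Qed.

Lemma sm_scale (a : R[i]) x n : v (a *: x) n = a * v x n.
Proof. by rewrite -[a *: x]addr0 (sm_linear mod_v) sm_zero addr0. Qed.

Lemma sm_sub x y n : v (x - y) n = v x n - v y n.
Proof. by rewrite addrC -scaleN1r (sm_linear mod_v) mulN1r addrC. Qed.

Lemma sm_sum (I : Type) (r : seq I) (P : pred I) (F : I -> X) n :
  v (\sum_(i <- r | P i) F i) n = \sum_(i <- r | P i) v (F i) n.
Proof.
elim/big_rec2: _ => [|i y S _ <-]; first exact: sm_zero.
by rewrite sm_add.
Qed.

Lemma sm_le x (c : R) : (lnorm p (v x) <= c%:E)%E = (nrm x <= c).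
Proof. by rewrite (sm_norm mod_v) lee_fin. Qed.

Lemma sm_coord x n : normc (v x n) <= nrm x.
Proof. by rewrite -lee_fin -(sm_norm mod_v) normc_le_lnorm. Qed.

Lemma sm_eq0 x : (forall n, v x n = 0) -> x = 0.
Proof.
move=> x0; apply: nrm_eq0; apply: EFin_inj; rewrite -(sm_norm mod_v).
by rewrite (_ : v x = 0) ?lnorm0//; apply/funext.
Qed.

Lemma sm_inj x y : (forall n, v x n = v y n) -> x = y.
Proof.
move=> xy; apply/eqP; rewrite -subr_eq0; apply/eqP/sm_eq0 => n.
by rewrite sm_sub xy subrr.
Qed.

Lemma ex_operator (F : X -> nat -> R[i]) (c : R) :
  (forall (a : R[i]) (x y : X) n, F (a *: x + y) n = a * F x n + F y n) ->
  (forall x, (lnorm p (F x) <= c%:E * lnorm p (v x))%E) ->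
  (b -> forall x, vanishing_tails p (F x)) ->
  exists T : bop X, (forall x n, v (T x) n = F x n) /\ (forall x, nrm (T x) <= c * nrm x).
Proof.
move=> Flin Fc Ftails.
have Fc' x : (lnorm p (F x) <= (c * nrm x)%:E)%E.
  by rewrite EFinM -(sm_norm mod_v).
have ex x : exists y, v y = F x.
  by apply: (sm_onto mod_v) => [|/Ftails //]; exact: le_lt_trans (Fc' x) (ltry _).
have [T TF] := choice ex.
have Tlin : linear T.
  by move=> a x y; apply: sm_inj => n; rewrite (sm_linear mod_v) !TF Flin.
have Tc x : nrm (T x) <= c * nrm x by rewrite -sm_le TF.
by exists (Bop (bounded_operatorP Tlin Tc)); split => //= x n; rewrite TF.
Qed.

Lemma synth_bound kap (x : nat -> R[i]) (c : R) (a : nat -> R[i]) : 0 <= c ->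
  (forall k, (lnorm p (blk kap k x) <= c%:E)%E) ->
  (lnorm p (fun n => (a (kap n) * x n)%R) <= c%:E * lnorm p a)%E.
Proof.
move=> c0 xc; rewrite -[c in c%:E](ger0_norm c0) -normc_rec -lnormZ_fun//.
apply: (lnorm_blk_le (kap := kap)) => // k.
rewrite (_ : blk _ _ _ = fun n => (a k * blk kap k x n)%R); last first.
  by apply/funext => n; rewrite /blk; case: eqP => [->//|_]; rewrite mulr0.
rewrite lnormZ_fun// Normc.normcM normc_rec ger0_norm// mulrC EFinM.
by apply: lee_wpmul2l; rewrite ?lee_fin ?normc_ge0.
Qed.

Lemma vanishing_tails_le (c : R) F g : 0 <= c ->
  (forall N, exists N', (lnorm p (tail N' F) <= c%:E * lnorm p (tail N g))%E) ->
  vanishing_tails p g -> vanishing_tails p F.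
Proof.
move=> c0 Fg gt e e0; have ec0 : 0 < e / (c + 1) by rewrite divr_gt0// ltr_wpDl.
have [N gN] := gt _ ec0; have [N' FN] := Fg N; exists N'.
apply: le_trans FN _; apply: (@le_trans _ _ (c%:E * (e / (c + 1))%:E)%E).
  by apply: lee_wpmul2l; rewrite ?lee_fin.
by rewrite -EFinM lee_fin mulrCA ger_pMr// ler_pdivrMr ?mul1r ?lerDl// ltr_wpDl.
Qed.

(** Bounded by [lnorm_blk_le].  When b holds, the first K blocks end at M K, so that a
    tail of y is spread over a tail. *)
Lemma ex_synthesis kap M (x : nat -> R[i]) (c : R) : 0 <= c ->
  (forall k, (lnorm p (blk kap k x) <= c%:E)%E) ->
  (b -> forall n K, (kap n < K)%N = (n < M K)%N) ->
  exists B : bop X, (forall y n, v (B y) n = v y (kap n) * x n) /\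
    (forall y, nrm (B y) <= c * nrm y).
Proof.
move=> c0 xc gal; apply: (@ex_operator (fun y n => v y (kap n) * x n) c).
- by move=> a y z n; rewrite (sm_linear mod_v) mulrDl mulrA.
- by move=> y; exact: synth_bound.
- move=> hb y; apply: (vanishing_tails_le c0) (sm_tails mod_v hb y) => N.
  exists (M N); have := synth_bound (tail N (v y)) c0 xc; apply: le_trans.
  apply: ler_lnorm => // n; rewrite /tail (gal hb).
  by case: ifP; rewrite ?mul0r.
Qed.

(** Bounded by [lnorm_blk_ge], because phi_k only sees the k-th block. *)
Lemma ex_coefficients kap M (phi : nat -> X -> R[i]) (c : R) : 0 <= c ->
  (forall k (a : R[i]) (x y : X), phi k (a *: x + y) = a * phi k x + phi k y) ->
  (forall k y, ((normc (phi k y))%:E <= c%:E * lnorm p (blk kap k (v y)))%E) ->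
  (b -> forall n K, (kap n < K)%N = (n < M K)%N) ->
  exists A : bop X, (forall y k, v (A y) k = phi k y) /\
    (forall y, nrm (A y) <= c * nrm y).
Proof.
move=> c0 philin phic gal; apply: (@ex_operator (fun y k => phi k y) c).
- by move=> a x y k; rewrite philin.
- move=> y; rewrite -[c in c%:E](ger0_norm c0) -normc_rec -lnormZ_fun//.
  apply: (lnorm_blk_ge (kap := kap)) => // k; apply: le_trans (phic k y) _.
  rewrite [X in (_ <= lnorm p X)%E](_ : _ = fun n => (c%:C * blk kap k (v y) n)%R); last first.
    by apply/funext => n; rewrite /blk; case: eqP => // _; rewrite mulr0.
  by rewrite lnormZ_fun// normc_rec ger0_norm.
- move=> hb y; apply: (vanishing_tails_le c0) (sm_tails mod_v hb y) => N.
  have [K NK] := galois_unbounded (gal hb) N; exists K.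
  rewrite -[c in c%:E](ger0_norm c0) -normc_rec -lnormZ_fun//.
  apply: (lnorm_blk_ge (kap := kap)) => // k.
  rewrite [X in (_ <= lnorm p X)%E](_ : _ = fun n => (c%:C * blk kap k (tail N (v y)) n)%R); last first.
    by apply/funext => n; rewrite /blk; case: eqP => // _; rewrite mulr0.
  rewrite lnormZ_fun// normc_rec ger0_norm// {1}/tail; case: ltnP => [_|Kk].
    by rewrite Normc.normc0 mule_ge0 ?lee_fin ?lnorm_ge0.
  apply: le_trans (phic k y) _; apply: lee_wpmul2l; first by rewrite lee_fin.
  apply: ler_lnorm => // n; rewrite /blk; case: eqP => // nk; rewrite /tail ltnNge.
  have -> // : (N <= n)%N by rewrite (leq_trans NK)// leqNgt -(gal hb) nk -leqNgt.
Qed.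

(** X is isomorphic to its square: B1 and B2 spread a sequence over the even and over
    the odd indices. *)
Lemma ex_square_decomposition :
  exists A1 B1 A2 B2 : bop X, [/\ A1 * B1 = 1, A2 * B2 = 1 & A1 * B2 = 0].
Proof.
have gal : b -> forall n K, (n./2 < K)%N = (n < K.*2)%N.
  by move=> _ n K; rewrite ltn_half_double.
pose x (i : bool) n : R[i] := if odd n == i then 1 else 0.
have xc i k : (lnorm p (blk half k (x i)) <= 1%:E)%E.
  apply: le_trans (lnorm_support (N := k.*2.+2) p1 _) _.
    move=> n kn; rewrite /blk; case: eqP => // nk; move: kn.
    by rewrite -doubleS leqNgt -ltn_half_double nk ltnSn.
  rewrite lee_fin (bigD1 (inord (i + k.*2)))//= big1 => [|j].
    rewrite addr0 inordK; last by case: i; rewrite ?ltnS.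
    rewrite /blk half_bit_double eqxx /x oddD odd_double addbF.
    by case: i; rewrite /= expr0n expr1n addr0 sqrtr1.
  move=> ji; rewrite /blk; case: eqP => [jk|]; last by rewrite Normc.normc0.
  rewrite /x; case: eqP => [ji'|]; last by rewrite Normc.normc0.
  case/eqP: ji; apply/val_inj; rewrite /= inordK; last by case: i {ji'}; rewrite ?ltnS.
  by rewrite -[LHS]odd_double_half jk ji'.
have [B1 [B1E _]] := ex_synthesis ler01 (xc false) gal.
have [B2 [B2E _]] := ex_synthesis ler01 (xc true) gal.
have exA (i : bool) : exists A : bop X, forall y k, v (A y) k = v y (i + k.*2)%N.
  have [||A [AE _]] := @ex_coefficients half double (fun k y => v y (i + k.*2)%N) 1 ler01 _ _ gal.
  - by move=> k a y z; exact: (sm_linear mod_v).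
  - move=> k y; rewrite mul1e; apply: le_trans (normc_le_lnorm _ (i + k.*2)%N p1).
    by rewrite /blk half_bit_double eqxx.
  - by exists A.
have [A1 A1E] := exA false; have [A2 A2E] := exA true.
exists A1, B1, A2, B2; split; apply/bopP => y; apply: sm_inj => k.
- by rewrite A1E B1E half_bit_double /x oddD odd_double mulr1.
- by rewrite A2E B2E half_bit_double /x oddD odd_double mulr1.
- by rewrite A1E B2E half_bit_double /x oddD odd_double mulr0 sm_zero.
Qed.

End SequenceModel.

(** * Finite colorings and the pigeonhole principle *)

Section FiniteColoring.
Context {R : realType} {T : Type}.

(** Color t by the integral part of (f t + M) / d. *)
Lemma real_coloring1 (f : T -> R) (M d : R) : 0 < d -> (forall t, `|f t| <= M) ->
  exists (F : finType) (c : T -> F), forall s t, c s = c t -> `|f s - f t| <= d.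
Proof.
move=> d0 fM; pose h t := (f t + M) / d.
have h0 t : 0 <= h t.
  by have := fM t; rewrite ler_norml => /andP[h1 _]; rewrite divr_ge0 ?(ltW d0)//; lra.
have hM t : (Num.truncn (h t) < (Num.truncn (2 * M / d)).+1)%N.
  rewrite ltnS le_truncn// ler_pM2r ?invr_gt0//.
  by have := fM t; rewrite ler_norml => /andP[_ h1]; lra.
exists 'I_(Num.truncn (2 * M / d)).+1, (fun t => Ordinal (hM t)) => s t [st].
have /andP[s1 s2] := truncn_itv (h0 s); have /andP[t1 t2] := truncn_itv (h0 t).
rewrite st in s1 s2.
have : `|h s - h t| <= 1.
  rewrite -natr1 in s2; rewrite -natr1 in t2.
  have key (m a b : R) : m <= a -> a < m + 1 -> m <= b -> b < m + 1 -> `|a - b| <= 1.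
    by rewrite ler_norml; lra.
  exact: key s1 s2 t1 t2.
rewrite /h -mulrBl opprD addrACA subrr addr0 normrM (gtr0_norm (_ : 0 < d^-1)) ?invr_gt0//.
by rewrite ler_pdivrMr// mul1r.
Qed.

Lemma real_coloring (r : nat) (f : nat -> T -> R) (d : R) : 0 < d ->
  (forall i, (i < r)%N -> exists M, forall t, `|f i t| <= M) ->
  exists (F : finType) (c : T -> F), forall s t, c s = c t ->
    forall i, (i < r)%N -> `|f i s - f i t| <= d.
Proof.
move=> d0; elim: r => [|r IH] fM.
  by exists unit, (fun=> tt).
have [i ir|F [c cP]] := IH; first by apply: fM; rewrite ltnS ltnW.
have [M fr] := fM r (ltnSn r).
have [F' [c' c'P]] := real_coloring1 d0 fr.
exists (F * F')%type, (fun t => (c t, c' t)) => s t [/cP st /c'P st'] i.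
by rewrite ltnS leq_eqVlt => /orP[/eqP->|/st].
Qed.

(** This serves both to find two terms of a sequence that are close to each other and
    to discretize the set of coordinates. *)
Lemma complex_coloring (r : nat) (f : nat -> T -> R[i]) (d : R) : 0 < d ->
  (forall i, (i < r)%N -> exists M, forall t, normc (f i t) <= M) ->
  exists (F : finType) (c : T -> F), forall s t, c s = c t ->
    forall i, (i < r)%N -> normc (f i s - f i t) <= d.
Proof.
move=> d0 fM; have d2 : 0 < d / 2 by lra.
have [|F [c cP]] := real_coloring (r := r) (f := fun i t => complex.Re (f i t)) d2.
  by move=> i /fM[M fiM]; exists M => t; exact: le_trans (ler_norm_Re _) (fiM t).
have [|F' [c' c'P]] := real_coloring (r := r) (f := fun i t => complex.Im (f i t)) d2.
  by move=> i /fM[M fiM]; exists M => t; exact: le_trans (ler_norm_Im _) (fiM t).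
exists (F * F')%type, (fun t => (c t, c' t)) => s t [/cP st /c'P st'] i ir.
have h1 := st i ir; have h2 := st' i ir; apply: le_trans (ler_normc_ReIm _) _.
by rewrite ReB ImB [leRHS]splitr lerD.
Qed.

End FiniteColoring.

Lemma pigeonhole (F : finType) (c : nat -> F) : exists i j, (i < j)%N /\ c i = c j.
Proof.
have : ~~ injectiveb (fun i : 'I_#|F|.+1 => c i).
  by apply/negP => /injectiveP /leq_card; rewrite card_ord ltnn.
move=> /injectivePn[i [j ij cij]].
have : (val i != val j) by [].
by rewrite neq_ltn => /orP[h|h]; [exists i, j|exists j, i].
Qed.

(** * The gliding hump *)

Section GlidingHump.
Context {R : realType} {p : \bar R} {X : completeNormedModType R[i]} {v : X -> nat -> R[i]}.
Hypothesis p1 : (1 <= p)%E.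
Hypothesis mod_v : seq_model p True v.

Lemma ex_tail_projection N : exists Q : bop X,
  (forall x n, v (Q x) n = tail N (v x) n) /\ (forall x, nrm (Q x) <= nrm x).
Proof.
have [|||Q [QE Qle]] := @ex_operator _ p True X v p1 mod_v (fun x n => tail N (v x) n) 1.
- by move=> a x y n; rewrite /tail (sm_linear mod_v); case: ifP; rewrite ?mulr0 ?addr0.
- move=> x; rewrite mul1e; apply: ler_lnorm => // n; rewrite /tail.
  by case: ifP; rewrite // Normc.normc0 normc_ge0.
- move=> _ x; apply: (vanishing_tails_le ler01) (sm_tails mod_v I x) => M; exists M.
  rewrite mul1e; apply: ler_lnorm => // n; rewrite /tail.
  by case: ifP => // _; case: ifP; rewrite // Normc.normc0 normc_ge0.
by exists Q; split => // x; rewrite -[leRHS]mul1r.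
Qed.

Lemma ex_basis N : exists x : X, forall n, v x n = (n == N)%:R.
Proof.
have [||x xE] := sm_onto mod_v (f := fun n => (n == N)%:R).
- apply: le_lt_trans (lnorm_support (N := N.+1) p1 _) (ltry _) => n Nn.
  by rewrite gtn_eqF.
- move=> _ d d0; exists N.+1; rewrite [tail _ _](_ : _ = fun=> 0).
    by rewrite lnorm0// lee_fin ltW.
  by apply/funext => n; rewrite /tail; case: ltnP => // Nn; rewrite gtn_eqF.
by exists x => n; rewrite xE.
Qed.

Variable Q : nat -> bop X.
Hypothesis QE : forall N x n, v (Q N x) n = tail N (v x) n.
Hypothesis Qle : forall N x, nrm (Q N x) <= nrm x.
Variable E : nat -> X.
Hypothesis EE : forall N n, v (E N) n = (n == N)%:R.

Lemma head_sum N x : x - Q N x = \sum_(n < N) v x n *: E n.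
Proof.
apply: (sm_inj p1 mod_v) => n; rewrite (sm_sub mod_v) QE (sm_sum mod_v) /tail.
under eq_bigr do rewrite (sm_scale mod_v) EE.
case: ltnP => nN.
  rewrite subr0 (bigD1 (Ordinal nN))//= eqxx mulr1 big1 ?addr0// => i ni.
  rewrite (_ : (n == i) = false) ?mulr0//; apply: contraNF ni => /eqP ni.
  exact/eqP/val_inj.
rewrite subrr big1// => i _; rewrite gtn_eqF ?mulr0//.
exact: leq_trans (ltn_ord i) nN.
Qed.

Lemma head_finrank N (T : bop X) : finrank (fun m x => v x m) (T - Q N * T).
Proof.
exists [seq (n, E n, T) | n <- iota 0 N] => x; rewrite big_map /=.
transitivity (T x - Q N (T x)); first by [].
rewrite head_sum -(big_mkord xpredT (fun n => v (T x) n *: E n)).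
by rewrite /index_iota subn0.
Qed.

Lemma head_finrank_right N (S T : bop X) : finrank (fun m x => v x m) (S * (T - T * Q N)).
Proof.
exists [seq (n, (S * T) (E n), 1) | n <- iota 0 N] => x; rewrite big_map /=.
transitivity (S (T (x - Q N x))); first by rewrite [T (x - _)]bop_sub.
rewrite head_sum -(big_mkord xpredT (fun n => v x n *: E n)) /index_iota subn0.
elim: (iota 0 N) => [|n s IH]; first by rewrite !big_nil !bop_zero.
by rewrite !big_cons !bop_add !bop_scale IH.
Qed.

(** T - Q T Q = (1 - Q) T + Q T (1 - Q), and 1 - Q has finite rank. *)
Lemma compress_finrank N (T : bop X) : finrank (fun m x => v x m) (T - Q N * T * Q N).
Proof.
have -> : T - Q N * T * Q N = (T - Q N * T) + Q N * (T - T * Q N).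
  by rewrite mulrBr mulrA addrA subrK.
by apply: finrankD; [exact: head_finrank|exact: head_finrank_right].
Qed.

Lemma tail_proj_nest M N x : (M <= N)%N -> Q N (Q M x) = Q N x.
Proof.
move=> MN; apply: (sm_inj p1 mod_v) => n; rewrite !QE /tail QE /tail.
by case: ltnP => // Nn; rewrite ltnNge (leq_trans MN Nn).
Qed.

Lemma tail_proj_nestr M N x : (M <= N)%N -> Q M (Q N x) = Q N x.
Proof.
move=> MN; apply: (sm_inj p1 mod_v) => n; rewrite !QE /tail QE /tail.
by case: ltnP => // nM; rewrite (leq_trans nM MN).
Qed.

Lemma tail_proj_mono M N x : (M <= N)%N -> nrm (Q N x) <= nrm (Q M x).
Proof. by move=> MN; rewrite -(tail_proj_nest x MN). Qed.

Lemma head_le N x : nrm (x - Q N x) <= nrm x.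
Proof.
rewrite -(sm_le mod_v) -(sm_norm mod_v); apply: ler_lnorm => // n.
rewrite (sm_sub mod_v) QE /tail; case: ifP; rewrite ?subr0// subrr.
by rewrite Normc.normc0 normc_ge0.
Qed.

Lemma tail_proj_vanish x d : 0 < d -> exists N, nrm (Q N x) <= d.
Proof.
move=> d0; have [N xN] := sm_tails mod_v I x d0; exists N.
rewrite -(sm_le mod_v); apply: le_trans xN; apply: ler_lnorm => // n.
by rewrite QE.
Qed.

Lemma tail_proj_vanish_from x d N0 : 0 < d -> exists N, (N0 <= N)%N /\ nrm (Q N x) <= d.
Proof.
move=> d0; have [N xN] := tail_proj_vanish x d0; exists (maxn N0 N).
by rewrite leq_maxl (le_trans _ xN)// tail_proj_mono// leq_maxr.
Qed.

Lemma basis_le N : nrm (E N) <= 1.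
Proof.
rewrite -(sm_le mod_v); apply: le_trans (lnorm_support (N := N.+1) p1 _) _.
  by move=> n Nn; rewrite EE gtn_eqF.
rewrite lee_fin (bigD1 ord_max)//= EE eqxx [normc _]Normc.normc1 big1 ?addr0// => i iN.
rewrite EE (_ : (i == N :> nat) = false) ?[normc _]Normc.normc0//.
by apply: contraNF iN => /eqP iN; apply/eqP/val_inj.
Qed.

Section Hump.
Variable T : bop X.
(** If this fails for M, then T is within 1/2 of T - Q M * T * Q M, which has finite
    rank by [compress_finrank]. *)
Hypothesis T_big : forall M, exists x, nrm x / 2 < nrm (Q M (T (Q M x))).

Lemma hump_block M : exists z N, [/\ (M <= N)%N, Q M z = z, Q N z = 0, nrm z <= 1 &
  1 / 2 < nrm (Q M (T z))].
Proof.
have [x Tx] := T_big M; have [c c0 Tc] := bop_nrm T.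
have x0 : 0 < nrm x.
  rewrite lt_def nrm_ge0 andbT; apply/eqP => nx0; move: Tx.
  by rewrite (nrm_eq0 nx0) !bop_zero nrm0 mul0r ltxx.
pose y := (nrm x)^-1%:C *: Q M x.
have ynrm : nrm y <= 1.
  by rewrite nrmZ normc_rec ger0_norm ?invr_ge0 ?nrm_ge0// mulrC ler_pdivrMr// mul1r.
have Ty : 1 / 2 < nrm (Q M (T y)).
  rewrite !bop_scale nrmZ normc_rec ger0_norm ?invr_ge0 ?nrm_ge0//.
  by rewrite [ltRHS]mulrC ltr_pdivlMr//; lra.
have Qy : Q M y = y by rewrite bop_scale tail_proj_nest.
pose d := (nrm (Q M (T y)) - 1 / 2) / (2 * c).
have d0 : 0 < d by rewrite divr_gt0 ?subr_gt0 ?mulr_gt0.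
have [N [MN yN]] := tail_proj_vanish_from y M d0.
exists (y - Q N y), N; split => //.
- by rewrite bop_sub Qy tail_proj_nestr.
- by rewrite bop_sub tail_proj_nest// subrr.
- exact: le_trans (head_le N y) ynrm.
have h : nrm (Q M (T (Q N y))) <= c * d.
  by rewrite (le_trans (Qle _ _))// (le_trans (Tc _))// ler_wpM2l// ltW.
have : nrm (Q M (T y)) <= nrm (Q M (T (y - Q N y))) + nrm (Q M (T (Q N y))).
  by rewrite (le_trans _ (nrmD _ _))// -!bop_add subrK.
have cd : c * d = (nrm (Q M (T y)) - 1 / 2) / 2 by rewrite /d; field; rewrite gt_eqF.
by rewrite cd in h; lra.
Qed.

(** The image of a block may have a large part to the left of M.  Among infinitely many
    blocks, two have nearly the same image there; half their difference is a block
    whose image is small to the left of M and still large to the right of it, since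
    the image of the earlier block is already small where the later one starts. *)
Lemma hump_separated M d : 0 < d -> exists z N,
  [/\ (M < N)%N, Q M z = z /\ Q N z = 0, nrm z <= 1,
      1 / 8 <= nrm (Q M (T z)) & nrm (T z - Q M (T z)) <= d /\ nrm (Q N (T z)) <= d].
Proof.
move=> d0; have [c c0 Tc] := bop_nrm T.
have step N : exists zN : X * nat, [/\ (N <= zN.2)%N, Q N zN.1 = zN.1 /\ Q zN.2 zN.1 = 0,
    nrm zN.1 <= 1, 1 / 2 < nrm (Q N (T zN.1)) & nrm (Q zN.2 (T zN.1)) <= 1 / 8].
  have [z [N' [NN' Qz Q'z z1 Tz]]] := hump_block N.
  have [|N'' [N'N'' TzN'']] := @tail_proj_vanish_from (T z) (1 / 8) N'.
    by rewrite divr_gt0.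
  exists (z, N''); split => //=; first exact: leq_trans N'N''.
  by split => //; rewrite -(tail_proj_nest z N'N'') Q'z bop_zero.
have [s sP] := choice step.
pose N i := iter i (fun N => (s N).2) M; pose z i := (s (N i)).1.
have Nmono : {homo N : i j / (i <= j)%N}.
  move=> i j /subnK <-; elim: (j - i)%N => // k IH.
  by rewrite addSn (leq_trans IH)//; have [] := sP (N (k + i)%N).
have zP i : [/\ Q (N i) (z i) = z i, Q (N i.+1) (z i) = 0, nrm (z i) <= 1,
    1 / 2 < nrm (Q (N i) (T (z i))) & nrm (Q (N i.+1) (T (z i))) <= 1 / 8].
  by have [_ [] *] := sP (N i).
have dM : 0 < d / (M%:R + 1) by rewrite divr_gt0// ltr_wpDl.
have [|F [col colP]] := @complex_coloring R nat M (fun n i => v (T (z i)) n) _ dM.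
  move=> n _; exists c => i; rewrite (le_trans (sm_coord p1 mod_v _ _))//.
  by rewrite (le_trans (Tc _))// ger_pMr//; have [] := zP i.
have [i [j [ij cij]]] := pigeonhole col.
pose w := (1 / 2)%:C *: (z j - z i).
have half_norm : normc (1 / 2 : R)%:C = 1 / 2 by rewrite normc_rec ger0_norm.
have [Qzi Q'zi zi1 Tzi Tzi'] := zP i; have [Qzj Q'zj zj1 Tzj Tzj'] := zP j.
have Nij : (N i.+1 <= N j)%N by exact: Nmono.
have Ni0 : (M <= N i)%N by exact: (Nmono 0%N).
have Nj0 : (M <= N j)%N by exact: (Nmono 0%N).
have [N' [jN' wN']] := @tail_proj_vanish_from (T w) d (maxn (N j.+1) M.+1) d0.
move: jN'; rewrite geq_max => /andP[jN' MN'].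
exists w, N'; split => //.
- split; rewrite bop_scale bop_sub.
    have -> : Q M (z i) = z i by rewrite -{1}Qzi tail_proj_nestr.
    by have -> : Q M (z j) = z j by rewrite -{1}Qzj tail_proj_nestr.
  have -> : Q N' (z j) = 0 by rewrite -(tail_proj_nest _ jN') Q'zj bop_zero.
  have iN' : (N i.+1 <= N')%N by apply: leq_trans jN'; apply: Nmono; exact: leqW.
  have -> : Q N' (z i) = 0 by rewrite -(tail_proj_nest _ iN') Q'zi bop_zero.
  by rewrite subrr scaler0.
- by rewrite nrmZ half_norm; have := nrmB (z j) (z i); lra.
- apply: le_trans (tail_proj_mono (T w) Nj0).
  rewrite !bop_scale nrmZ half_norm.
  have : nrm (Q (N j) (T (z i))) <= 1 / 8.
    by rewrite (le_trans (tail_proj_mono _ Nij)).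
  have : nrm (Q (N j) (T (z j))) <= nrm (Q (N j) (T (z j - z i))) + nrm (Q (N j) (T (z i))).
    by rewrite (le_trans _ (nrmD _ _))// -!bop_add subrK.
  lra.
- split => //; rewrite head_sum (le_trans (nrm_sum _ _ _))//.
  apply: (@le_trans _ _ (\sum_(n < M) d / (M%:R + 1))).
    apply: ler_sum => n _; rewrite nrmZ bop_scale bop_sub (sm_scale mod_v) (sm_sub mod_v).
    rewrite Normc.normcM half_norm.
    have h := colP _ _ (esym cij) n (ltn_ord n).
    have h0 := normc_ge0 (v (T (z j)) n - v (T (z i)) n).
    by rewrite (le_trans (ler_wpM2l _ (basis_le n)))//; lra.
  rewrite sumr_const card_ord -[leLHS]mulr_natr -mulrA ger_pMr//.
  by rewrite mulrC ler_pdivrMr ?mul1r ?lerDl// ltr_wpDl.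
Qed.
End Hump.

End GlidingHump.

Lemma ex_block_index (N : nat -> nat) : N 0%N = 0%N -> (forall k, (N k < N k.+1)%N) ->
  exists kap, forall n K, (kap n < K)%N = (n < N K)%N.
Proof.
move=> N0 Ninc.
have Nmono i j : (i <= j)%N -> (N i <= N j)%N.
  by move=> /subnK <-; elim: (j - i)%N => // k IH; rewrite (leq_trans IH)// addSn ltnW.
have Nid k : (k <= N k)%N by elim: k => // k /leq_ltn_trans; apply.
have ex n : exists k, (n < N k.+1)%N by exists n; exact: leq_trans (Nid _).
exists (fun n => ex_minn (ex n)) => n K; case: ex_minnP => k nk kmin.
apply/idP/idP => [kK|nK]; first exact: leq_trans nk (Nmono _ _ kK).
by case: K nK => [|K] nK; [rewrite N0 in nK|rewrite ltnS kmin].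
Qed.

Section GlidingHumpDichotomy.
Context {R : realType} {p : \bar R} {X : completeNormedModType R[i]} {v : X -> nat -> R[i]}.
Hypothesis p1 : (1 <= p)%E.
Hypothesis mod_v : seq_model p True v.

Lemma geometric_half_sum K : \sum_(k < K) (2^-1 : R) ^+ k <= 2.
Proof.
suff -> : \sum_(k < K) (2^-1 : R) ^+ k = 2 - 2 * 2^-1 ^+ K.
  by rewrite gerDl oppr_le0 mulr_ge0// exprn_ge0.
elim: K => [|K IH]; first by rewrite big_ord0 expr0; ring.
by rewrite big_ord_recr/= IH exprS; field.
Qed.

(** B places the coefficient y_k on the block w_k, U on the part u_k of T w_k in the same
    interval, and A applies functionals norming the u_k, so that A U = 1.  As T B is
    close to U, the operator A T B is close to 1. *)
Lemma factor_or_finrank_tails (T : bop X) : (exists A B, A * T * B = 1) \/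
  (exists F (c : R), [/\ finrank (fun m x => v x m) F, c < 1 &
     forall x, nrm ((T - F) x) <= c * nrm x]).
Proof.
have [Q QP] := choice (ex_tail_projection p1 mod_v).
have QE N x n : v (Q N x) n = tail N (v x) n by have [+ _] := QP N.
have Qle N x : nrm (Q N x) <= nrm x by have [_] := QP N.
have [E EE] := choice (ex_basis p1 mod_v).
have [[M small]|big] := pselect (exists M, forall x, nrm (Q M (T (Q M x))) <= nrm x / 2).
  right; exists (T - Q M * T * Q M), (1 / 2); split; [exact: (compress_finrank p1 mod_v)|lra|].
  by move=> x; rewrite subKr [leRHS]mulrC mulrA mulr1; exact: small.
left; have T_big M : exists x, nrm x / 2 < nrm (Q M (T (Q M x))).
  apply: contrapT => h; apply: big; exists M => x; rewrite leNgt; apply/negP => hx.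
  by apply: h; exists x.
(* Below, A has norm at most 16 and T B - U has norm at most 4 / 128. *)
pose d k : R := 128^-1 * 2^-1 ^+ k.
have d0 k : 0 < d k by rewrite mulr_gt0 ?exprn_gt0.
have d_small k : d k <= 1 / 128.
  by rewrite div1r ger_pMr// exprn_ile1//; lra.
have hump (Mk : nat * nat) := hump_separated p1 mod_v QE Qle EE T_big Mk.1 (d0 Mk.2).
have [z zP0] := choice hump; have [N' zP] := choice zP0.
pose N k := iteri k (fun k M => N' (M, k)) 0%N.
pose w k := z (N k, k).
have wP k : [/\ (N k < N k.+1)%N, Q (N k) (w k) = w k /\ Q (N k.+1) (w k) = 0,
    nrm (w k) <= 1, 1 / 8 <= nrm (Q (N k) (T (w k))) &
    nrm (T (w k) - Q (N k) (T (w k))) <= d k /\ nrm (Q (N k.+1) (T (w k))) <= d k].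
  exact: zP (N k, k).
have Ninc k : (N k < N k.+1)%N by have [] := wP k.
have [kap gal] := ex_block_index (erefl : N 0%N = 0%N) Ninc.
have kapE n k : (kap n == k) = (N k <= n < N k.+1)%N.
  by rewrite -gal ltnS [(N k <= n)%N]leqNgt -gal -leqNgt eqn_leq andbC.
pose P k := Q (N k) - Q (N k.+1).
have PE k x n : v (P k x) n = blk kap k (v x) n.
  rewrite /P bopBE (sm_sub mod_v) !QE /tail /blk kapE.
  case: ltnP => nN /=; first by rewrite (ltn_trans nN (Ninc k)) subrr.
  by case: ltnP; rewrite ?subr0// subrr.
have PP k x : P k (P k x) = P k x.
  by apply: (sm_inj p1 mod_v) => n; rewrite PE /blk PE /blk; case: eqP.
have Pnrm k x : (lnorm p (blk kap k (v x)) = (nrm (P k x))%:E)%E.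
  by rewrite -(sm_norm mod_v); congr lnorm; apply/funext => n; rewrite PE.
have Pw k : P k (w k) = w k.
  by have [_ [Qw Q'w] _ _ _] := wP k; rewrite /P bopBE Qw Q'w subr0.
pose u k := P k (T (w k)).
have u_big k : 1 / 16 <= nrm (u k).
  have [_ _ _ Tw [_ Tw']] := wP k.
  have := nrmD (u k) (Q (N k.+1) (T (w k))); rewrite {1}/u /P bopBE subrK.
  by have := d_small k; lra.
have u_close k : nrm (T (w k) - u k) <= 2 * d k.
  have [_ _ _ _ [Tw Tw']] := wP k.
  have -> : T (w k) - u k = (T (w k) - Q (N k) (T (w k))) + Q (N k.+1) (T (w k)).
    by rewrite /u /P bopBE opprB addrA addrAC.
  by apply: le_trans (nrmD _ _) _; lra.
have u_neq0 k : u k != 0.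
  by apply/eqP => u0; have := u_big k; rewrite u0 nrm0; lra.
have [h hP] := choice (fun k => hahn_banach (u_neq0 k)).
have [c c0 Tc] := bop_nrm T.
have [||A [AE Ale]] := @ex_coefficients _ _ _ _ _ p1 mod_v kap N
    (fun k y => h k (P k y)) 16 (ler0n _ _) _ _ (fun=> gal).
- by move=> k a x y; have [hlin _ _] := hP k; rewrite bop_add bop_scale hlin.
- move=> k y; have [_ hle _] := hP k; rewrite Pnrm -EFinM lee_fin.
  rewrite (le_trans (hle _))// mulrC ler_wpM2r ?nrm_ge0//.
  by rewrite invf_ple ?posrE ?nrm_gt0//; have := u_big k; lra.
have blkE (f : nat -> X) k : (forall k, P k (f k) = f k) ->
    blk kap k (fun n => v (f (kap n)) n) = v (f k).
  move=> Pf; apply/funext => n; rewrite -[f k]Pf PE /blk; case: eqP => // ->.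
  by [].
have [|B [BE Ble]] := @ex_synthesis _ _ _ _ _ p1 mod_v kap N
    (fun n => v (w (kap n)) n) 1 ler01 _ (fun=> gal).
  by move=> k; rewrite blkE// (sm_le mod_v); have [] := wP k.
have [|U [UE Ule]] := @ex_synthesis _ _ _ _ _ p1 mod_v kap N
    (fun n => v (u (kap n)) n) (c + 1) (addr_ge0 (ltW c0) ler01) _ (fun=> gal).
  move=> k; rewrite blkE; last by move=> j; rewrite PP.
  rewrite (sm_le mod_v); have [_ _ wk1 _ _] := wP k.
  have := Tc (w k); have := u_close k; have := d_small k.
  have := nrmB (T (w k)) (T (w k) - u k); rewrite subKr.
  have := ler_wpM2l (ltW c0) wk1; rewrite mulr1; lra.
have AU y : A (U y) = y.
  apply: (sm_inj p1 mod_v) => k; rewrite AE; have [hlin _ hu] := hP k.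
  have -> : P k (U y) = v y k *: u k + 0.
    rewrite addr0; apply: (sm_inj p1 mod_v) => n; rewrite PE (sm_scale mod_v) /blk UE.
    case: eqP => [->//|/eqP nk]; rewrite /u PE /blk (negbTE nk) mulr0//.
  rewrite hlin hu mulr1; have -> : h k 0 = 0.
    by have := hlin (-1) 0 0; rewrite scaleN1r oppr0 addr0 mulN1r addNr.
  by rewrite addr0.
(* On finitely supported vectors the errors 2 (d k) are summed. *)
have head_close y K : nrm ((T * B - U) (y - Q K y)) <= 1 / 32 * nrm y.
  have S (f : nat -> X) (V : bop X) : (forall k, P k (f k) = f k) ->
      (forall x n, v (V x) n = v x (kap n) * v (f (kap n)) n) ->
      V (y - Q K y) = \sum_(k < K) v y k *: f k.
    move=> Pf VE; apply: (sm_inj p1 mod_v) => n.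
    rewrite VE (sm_sub mod_v) QE (sm_sum mod_v) /tail.
    under eq_bigr do rewrite (sm_scale mod_v).
    have off k : k != kap n -> v (f k) n = 0.
      by move=> kn; rewrite -Pf PE /blk eq_sym (negbTE kn).
    case: ltnP => nK; last first.
      rewrite subrr mul0r big1// => k _; rewrite off ?mulr0//.
      by rewrite neq_ltn (leq_trans (ltn_ord k) nK).
    rewrite subr0 (bigD1 (Ordinal nK))//= big1 ?addr0// => k kn.
    by rewrite off ?mulr0.
  rewrite bopBE bopME (S w B)// (S u U)//; last by move=> k; rewrite PP.
  have -> : T (\sum_(k < K) v y k *: w k) - \sum_(k < K) v y k *: u k =
      \sum_(k < K) v y k *: (T (w k) - u k).
    rewrite bop_sum -sumrB; apply: eq_bigr => k _.
    by rewrite bop_scale [RHS]scalerBr.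
  apply: le_trans (nrm_sum _ _ _) _.
  apply: (@le_trans _ _ (\sum_(k < K) nrm y * (2 * 128^-1) * 2^-1 ^+ k)).
    apply: ler_sum => k _; rewrite nrmZ -!mulrA.
    apply: ler_pM; [exact: normc_ge0|exact: nrm_ge0|exact: (sm_coord p1 mod_v)|].
    exact: u_close.
  rewrite -mulr_sumr; have := geometric_half_sum K; have := nrm_ge0 y; nra.
have close y : nrm ((T * B - U) y) <= 1 / 32 * nrm y.
  apply/ler_addgt0Pr => eps eps0; have [c' c'0 Tc'] := bop_nrm (T * B - U).
  have [K yK] := tail_proj_vanish p1 mod_v QE y (divr_gt0 eps0 c'0).
  have -> : (T * B - U) y = (T * B - U) (y - Q K y) + (T * B - U) (Q K y).
    by rewrite -bop_add subrK.
  apply: le_trans (nrmD _ _) _; apply: lerD => //.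
  by apply: le_trans (Tc' _) _; rewrite mulrC -ler_pdivlMr.
have half : (1 / 2 : R) < 1 by lra.
have [|S GS] := @neumann _ _ (1 - A * T * B) (1 / 2) half.
  move=> x; have -> : (1 - A * T * B) x = - A ((T * B - U) x).
    by rewrite bop_sub AU opprB.
  by rewrite nrmN (le_trans (Ale _))//; have := close x; lra.
by exists A, (B * S); rewrite mulrA -GS subKr.
Qed.

End GlidingHumpDichotomy.

(** * The absolute value of a functional on bounded sequences *)

Section AbsoluteValueFunctional.
Context {R : realType} {X : completeNormedModType R[i]} {v : X -> nat -> R[i]}.
Hypothesis mod_v : seq_model +oo False v.
Implicit Types (g h : nat -> R).

Let p1 : (1 <= +oo :> \bar R)%E. Proof. exact: leey. Qed.

Lemma sup_norm_le x (c : R) : (forall n, normc (v x n) <= c) -> nrm x <= c.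
Proof.
move=> xc; rewrite -(sm_le mod_v) /=; apply: ge_ereal_sup => _ [n _ <-].
by rewrite lee_fin.
Qed.

Lemma ex_bounded_sequence (f : nat -> R[i]) (c : R) : (forall n, normc (f n) <= c) ->
  exists x, v x = f.
Proof.
move=> fc; apply: (sm_onto mod_v) => //.
apply: (@le_lt_trans _ _ c%:E); last exact: ltry.
by apply: ge_ereal_sup => _ [n _ <-]; rewrite lee_fin.
Qed.

Definition rbounded g := exists c, forall n, `|g n| <= c.

Lemma rbounded_lin (a : R) g h : rbounded g -> rbounded h ->
  rbounded (fun n => a * g n + h n).
Proof.
move=> [c gc] [d hd]; exists (`|a| * c + d) => n.
by rewrite (le_trans (ler_normD _ _))// lerD// normrM ler_wpM2l.
Qed.

Lemma rbounded_cst (a : R) : rbounded (fun=> a).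
Proof. by exists `|a|. Qed.

Lemma rbounded_add g h : rbounded g -> rbounded h -> rbounded (fun n => g n + h n).
Proof.
move=> bg bh; have := rbounded_lin 1 bg bh; congr rbounded.
by apply/funext => n; rewrite mul1r.
Qed.

Lemma rbounded_scale (a : R) g : rbounded g -> rbounded (fun n => a * g n).
Proof.
move=> bg; have := rbounded_lin a bg (rbounded_cst 0); congr rbounded.
by apply/funext => n; rewrite addr0.
Qed.

Record positive_functional (lam : (nat -> R) -> R) : Prop := PositiveFunctional {
  pf_linear : forall (a : R) g h, rbounded g -> rbounded h ->
    lam (fun n => a * g n + h n) = a * lam g + lam h;
  pf_ge0 : forall g, rbounded g -> (forall n, 0 <= g n) -> 0 <= lam g }.

(** [lam] is the least positive functional dominating [mu]; minimality is expressed by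
    [af_approx]. *)
Record abs_functional (mu : X -> R[i]) (lam : (nat -> R) -> R) : Prop := AbsFunctional {
  af_positive : positive_functional lam;
  af_le : forall y, normc (mu y) <= lam (fun n => normc (v y n));
  af_approx : forall g (e : R), rbounded g -> (forall n, 0 <= g n) -> 0 < e ->
    exists y, (forall n, normc (v y n) <= g n) /\ lam g - e <= normc (mu y) }.

Variable mu : X -> R[i].
Variable c : R.
Hypothesis mu_linear : forall (a : R[i]) x y, mu (a *: x + y) = a * mu x + mu y.
Hypothesis mu_le : forall x, normc (mu x) <= c * nrm x.

Let dominated g := [set r | exists y, (forall n, normc (v y n) <= g n) /\ r = normc (mu y)].
Let L g := sup (dominated g).
Let nonneg g := forall n, 0 <= g n.

Let mu0 : mu 0 = 0.
Proof. by have := mu_linear (-1) 0 0; rewrite scaleN1r oppr0 addr0 mulN1r addNr. Qed.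

Let v0 n : v 0 n = 0. Proof. exact: (sm_zero mod_v). Qed.

Let dom_sup g : rbounded g -> nonneg g -> has_sup (dominated g).
Proof.
move=> [M gM] g0; split; first by exists (normc (mu 0)), 0; split => // n; rewrite v0 Normc.normc0.
exists (`|c| * M) => _ [y [yg ->]].
apply: le_trans (mu_le y) _; apply: le_trans (ler_norm _) _.
rewrite normrM (ger0_norm (nrm_ge0 _)) ler_wpM2l//; apply: sup_norm_le => n.
by apply: le_trans (yg n) _; apply: le_trans (ler_norm _) (gM n).
Qed.

Let L_ub g y : rbounded g -> nonneg g -> (forall n, normc (v y n) <= g n) -> normc (mu y) <= L g.
Proof.
move=> bg g0 yg; apply: ub_le_sup; first by have [] := dom_sup bg g0.
by exists y.
Qed.

Let L_ex g (e : R) : rbounded g -> nonneg g -> 0 < e ->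
  exists y, (forall n, normc (v y n) <= g n) /\ L g - e < normc (mu y).
Proof.
move=> bg g0 e0; have [_ [y [yg ->]] h] := sup_adherent e0 (dom_sup bg g0).
by exists y.
Qed.

Let L_le g (M : R) : rbounded g -> nonneg g ->
  (forall y, (forall n, normc (v y n) <= g n) -> normc (mu y) <= M) -> L g <= M.
Proof.
move=> bg g0 h; apply: ge_sup; first by have [] := dom_sup bg g0.
by move=> _ [y [yg ->]]; exact: h.
Qed.

(** A vector dominated by g + h splits into vectors dominated by g and by h, in the
    proportion g / (g + h); conversely, vectors dominated by g and by h can be rotated
    so that the values of mu add up in modulus. *)
Let L_add g h : rbounded g -> rbounded h -> nonneg g -> nonneg h ->
  L (fun n => g n + h n) = L g + L h.
Proof.
move=> bg bh g0 h0; have bgh := rbounded_add bg bh.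
have gh0 : nonneg (fun n => g n + h n) by move=> n; rewrite addr_ge0.
apply/eqP; rewrite eq_le; apply/andP; split.
  apply: L_le => // y ygh.
  pose t n := g n / (g n + h n).
  have t01 n : 0 <= t n <= 1.
    rewrite /t divr_ge0//=; have [->|gh] := eqVneq (g n + h n) 0; first by rewrite invr0 mulr0.
    by rewrite ler_pdivrMr ?mul1r ?lerDl// lt_def gh gh0.
  have y1g n : normc ((t n)%:C * v y n) <= g n.
    rewrite Normc.normcM normc_rec; have /andP[t0 t1] := t01 n; rewrite ger0_norm//.
    apply: le_trans (ler_wpM2l t0 (ygh n)) _; rewrite /t.
    have [->|gh] := eqVneq (g n + h n) 0; first by rewrite mulr0.
    by rewrite divfK.
  have y2h n : normc ((1 - t n)%:C * v y n) <= h n.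
    rewrite Normc.normcM normc_rec; have /andP[t0 t1] := t01 n; rewrite ger0_norm ?subr_ge0//.
    apply: le_trans (ler_wpM2l _ (ygh n)) _; first by rewrite subr_ge0.
    rewrite mulrBl mul1r /t.
    have [->|gh] := eqVneq (g n + h n) 0; first by rewrite mulr0 subr0.
    by rewrite divfK// addrC addKr.
  have [M gM] := bg; have [M' hM] := bh.
  have [y1 y1E] := ex_bounded_sequence (fun n => le_trans (y1g n) (le_trans (ler_norm _) (gM n))).
  have [y2 y2E] := ex_bounded_sequence (fun n => le_trans (y2h n) (le_trans (ler_norm _) (hM n))).
  have -> : y = 1 *: y1 + y2.
    apply: (sm_inj p1 mod_v) => n; rewrite (sm_linear mod_v) y1E y2E mul1r -mulrDl.
    by rewrite -rmorphD addrCA subrr addr0 mul1r.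
  rewrite mu_linear mul1r; apply: le_trans (ler_normcD _ _) _.
  by apply: lerD; apply: L_ub => // n; rewrite ?y1E ?y2E.
apply/ler_addgt0Pr => e e0; have e2 : 0 < e / 2 by lra.
have [y1 [y1g hy1]] := L_ex bg g0 e2; have [y2 [y2h hy2]] := L_ex bh h0 e2.
have [w1 w11 w1E] := phaseP (mu y1); have [w2 w21 w2E] := phaseP (mu y2).
have : normc (mu (w1 *: y1 + w2 *: y2)) <= L (fun n => g n + h n).
  apply: L_ub => // n; rewrite (sm_linear mod_v) (sm_scale mod_v).
  apply: le_trans (ler_normcD _ _) _; rewrite !Normc.normcM w11 w21 !mul1r.
  exact: lerD.
have -> : mu (w1 *: y1 + w2 *: y2) = (normc (mu y1) + normc (mu y2))%:C.
  by rewrite mu_linear -[w2 *: y2]addr0 mu_linear mu0 addr0 w1E w2E rmorphD.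
by rewrite normc_rec ger0_norm ?addr_ge0 ?normc_ge0//; lra.
Qed.

Let L_scale_le (a : R) g : 0 < a -> rbounded g -> nonneg g -> a * L g <= L (fun n => a * g n).
Proof.
move=> a0 bg g0; have bag := rbounded_scale a bg.
have ag0 : nonneg (fun n => a * g n) by move=> n; rewrite mulr_ge0// ltW.
rewrite mulrC -ler_pdivlMr//; apply: L_le => // y yg.
rewrite ler_pdivlMr// mulrC -[a in a * _](ger0_norm (ltW a0)) -normc_rec -Normc.normcM.
have -> : a%:C * mu y = mu (a%:C *: y) by rewrite -[_ *: y]addr0 mu_linear mu0 addr0.
apply: L_ub => // n; rewrite (sm_scale mod_v) Normc.normcM normc_rec ger0_norm ?(ltW a0)//.
by rewrite ler_wpM2l// ltW.
Qed.

Let L_scale (a : R) g : 0 < a -> rbounded g -> nonneg g -> L (fun n => a * g n) = a * L g.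
Proof.
move=> a0 bg g0; apply/eqP; rewrite eq_le L_scale_le// andbT.
rewrite -ler_pdivrMl//; have ai : 0 < a^-1 by rewrite invr_gt0.
have := L_scale_le ai (rbounded_scale a bg) (fun n => mulr_ge0 (ltW a0) (g0 n)).
rewrite (_ : (fun n => a^-1 * (a * g n)) = g)//.
by apply/funext => n; rewrite mulKf// gt_eqF.
Qed.

(** The supremum L g of |mu y| over |y| <= g is additive and positively homogeneous on
    nonnegative g.  Any bounded g becomes nonnegative by adding a constant, and
    L (g + C) - L C is independent of the constant C, so this extends L linearly. *)
Lemma ex_abs_functional : exists lam, abs_functional mu lam.
Proof.
have shift g : exists M : R, rbounded g -> nonneg (fun n => g n + M) /\ 0 <= M.
  have [[M gM]|] := pselect (rbounded g); last by exists 0.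
  exists M => _; split=> [n|]; last by apply: le_trans (gM 0%N).
  by have := gM n; rewrite ler_norml => /andP[h _]; rewrite -lerBlDr sub0r.
have [C CP] := choice shift.
pose lam g := L (fun n => g n + C g) - L (fun=> C g).
have lamE g M : rbounded g -> nonneg (fun n => g n + M) -> 0 <= M ->
    lam g = L (fun n => g n + M) - L (fun=> M).
  move=> bg gM M0; have [gC C0] := CP g bg.
  have bC := rbounded_cst (C g); have bM := rbounded_cst M.
  have h1 := L_add (rbounded_add bg bC) bM gC (fun=> M0).
  have h2 := L_add (rbounded_add bg bM) bC gM (fun=> C0).
  have e : (fun n => g n + C g + M) = (fun n => g n + M + C g).
    by apply/funext => n; rewrite addrAC.
  by rewrite /lam; move: h1 h2; rewrite e => ->; lra.
have L0 : L (fun=> 0) = 0.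
  have := L_add (rbounded_cst 0) (rbounded_cst 0) (fun=> lexx 0) (fun=> lexx 0).
  by rewrite (_ : (fun=> 0 + 0 : R) = fun=> 0); [lra|apply/funext => n; rewrite addr0].
have lam_nonneg g : rbounded g -> nonneg g -> lam g = L g.
  move=> bg g0; rewrite (lamE g 0)// ?L0 ?subr0; last by move=> n; rewrite addr0.
  by congr L; apply/funext => n; rewrite addr0.
have lam_add g h : rbounded g -> rbounded h -> lam (fun n => g n + h n) = lam g + lam h.
  move=> bg bh; have [gC C0] := CP g bg; have [hC D0] := CP h bh.
  have bC := rbounded_cst (C g); have bD := rbounded_cst (C h).
  have e : (fun n => g n + h n + (C g + C h)) = (fun n => (g n + C g) + (h n + C h)).
    by apply/funext => n; rewrite addrACA.
  rewrite (lamE _ (C g + C h)); [|exact: rbounded_add| |exact: addr_ge0]; last first.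
    by move=> n; rewrite addrACA addr_ge0.
  rewrite e (L_add (rbounded_add bg bC) (rbounded_add bh bD) gC hC).
  by rewrite (L_add bC bD (fun=> C0) (fun=> D0)) /lam; lra.
have lam_pos (a : R) g : 0 < a -> rbounded g -> lam (fun n => a * g n) = a * lam g.
  move=> a0 bg; have [gC C0] := CP g bg; have bC := rbounded_cst (C g).
  have e : (fun n => a * g n + a * C g) = (fun n => a * (g n + C g)).
    by apply/funext => n; rewrite mulrDr.
  rewrite (lamE _ (a * C g)); [|exact: rbounded_scale| |by rewrite mulr_ge0// ltW]; last first.
    by move=> n; rewrite -mulrDr mulr_ge0// ltW.
  rewrite e (L_scale a0 (rbounded_add bg bC) gC) (L_scale a0 bC (fun=> C0)).
  by rewrite -mulrBr.
have lam0 : lam (fun=> 0) = 0 by rewrite lam_nonneg//; exact: rbounded_cst.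
have lam_opp g : rbounded g -> lam (fun n => - g n) = - lam g.
  move=> bg; have bg' : rbounded (fun n => - g n).
    by case: bg => M gM; exists M => n; rewrite normrN.
  have := lam_add _ _ bg bg'; rewrite (_ : (fun n => g n - g n) = fun=> 0).
    by rewrite lam0; lra.
  by apply/funext => n; rewrite subrr.
have lam_scale (a : R) g : rbounded g -> lam (fun n => a * g n) = a * lam g.
  move=> bg; have [a0|a0|->] := ltgtP a 0; last 2 first.
  - exact: lam_pos.
  - rewrite mul0r (_ : (fun n => 0 * g n) = fun=> 0) ?lam0//.
    by apply/funext => n; exact: mul0r.
  have e : (fun n => a * g n) = (fun n => - ((- a) * g n)).
    by apply/funext => n; rewrite mulNr opprK.
  by rewrite e lam_opp ?lam_pos ?oppr_gt0 ?mulNr ?opprK//; exact: rbounded_scale.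
exists lam; split.
- split=> [a g h bg bh|g bg g0].
    by rewrite lam_add ?lam_scale//; exact: rbounded_scale.
  rewrite lam_nonneg//; apply: le_trans (normc_ge0 (mu 0)) _.
  by apply: L_ub => // n; rewrite v0 Normc.normc0.
- move=> y; have bdd_y : rbounded (fun n => normc (v y n)).
    exists (nrm y) => n; rewrite ger0_norm ?normc_ge0//; exact: (sm_coord p1 mod_v).
  rewrite lam_nonneg// => [|n]; last exact: normc_ge0.
  by apply: L_ub => // n; exact: normc_ge0.
- move=> g e bg g0 e0; rewrite lam_nonneg//; have [y [yg hy]] := L_ex bg g0 e0.
  by exists y; split => //; exact: ltW.
Qed.

End AbsoluteValueFunctional.

(** * Finitely additive measures on the natural numbers *)

Arguments abs_functional {R X} v mu lam.

Section Rosenthal.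
Context {R : realType}.

(** Split the indices into infinitely many infinite classes.  If no class satisfies the
    conclusion, each contains an index whose measure gives mass more than d to the
    rest of its class.  These exceptional indices form a set that has d less mass for
    each of their measures, and this can be repeated at most M / d times. *)
Lemma rosenthal_disjointification (nu : nat -> set nat -> R) (M d : R) : 0 < d ->
  (forall k A, 0 <= nu k A) ->
  (forall k A B, A `&` B = set0 -> nu k (A `|` B) = nu k A + nu k B) ->
  (forall k, nu k setT <= M) ->
  exists s : nat -> nat, injective s /\ forall i, nu (s i) (range s `\ s i) <= d.
Proof.
move=> d0 nu0 nuU nuM.
have nu_mono k A B : A `<=` B -> nu k A <= nu k B.
  by move=> AB; rewrite -(setDUK AB) nuU ?setDIK// lerDl.
suff descent r : forall t : nat -> nat, injective t ->
    (forall i, nu (t i) (range t) <= r%:R * d) ->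
    exists s : nat -> nat, injective s /\ forall i, nu (s i) (range s `\ s i) <= d.
  apply: (descent (Num.truncn (M / d)).+1 id) => // i.
  apply: le_trans (nu_mono _ _ _ (@subsetT _ _)) _.
  apply: le_trans (nuM i) _; rewrite -ler_pdivrMr// ltW//.
  have [M0|M0] := leP 0 (M / d); first by have /andP[] := truncn_itv M0.
  by apply: lt_le_trans M0 _; exact: ler0n.
elim: r => [|r IH] t tinj tr.
  exists t; split => // i; apply: le_trans (nu_mono _ _ _ (@subDsetl _ _ _)) _.
  by apply: le_trans (tr i) _; rewrite mul0r ltW.
pose q (i j : nat) := t (pickle (i, j)).
have qinj i j i' j' : q i j = q i' j' -> i = i' /\ j = j'.
  by move=> /tinj /(pcan_inj pickleK) [].
have [[i good]|bad] := pselect (exists i, forall j, nu (q i j) (range (q i) `\ q i j) <= d).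
  by exists (q i); split => // j j' /qinj[].
have /choice[f fP] : forall i, exists j, d < nu (q i j) (range (q i) `\ q i j).
  move=> i; apply: contrapT => h; apply: bad; exists i => j; rewrite leNgt; apply/negP => hj.
  by apply: h; exists j.
apply: (IH (fun i => q i (f i))) => [i i' /qinj[]//|i].
have disj : range (fun i => q i (f i)) `&` (range (q i) `\ q i (f i)) = set0.
  apply/seteqP; split => // _ [[k _ <-] [[j _ /qinj[ik _]] ne]].
  by apply: ne; rewrite ik.
have := nuU (q i (f i)) _ _ disj; have := fP i.
have : nu (q i (f i)) (range (fun i => q i (f i)) `|` (range (q i) `\ q i (f i)))
    <= r.+1%:R * d.
  apply: le_trans (tr _); apply: nu_mono => _ [[k _ <-]|[[j _ <-] _]].
    by exists (pickle (k, f k)).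
  by exists (pickle (i, j)).
rewrite -natr1 mulrDl mul1r => h1 h2 h3; rewrite h3 in h1; lra.
Qed.

End Rosenthal.

Section PositiveFunctionalTheory.
Context {R : realType} {lam : (nat -> R) -> R}.
Hypothesis pf : positive_functional lam.
Implicit Types (g h : nat -> R) (A B : set nat).

Lemma pf_zero : lam (fun=> 0) = 0.
Proof.
have := pf_linear pf 1 (rbounded_cst 0) (rbounded_cst 0).
by rewrite (_ : (fun=> 1 * 0 + 0 : R) = fun=> 0); [lra|apply/funext => n; rewrite mulr0 addr0].
Qed.

Lemma pf_add g h : rbounded g -> rbounded h -> lam (fun n => g n + h n) = lam g + lam h.
Proof.
move=> bg bh; have := pf_linear pf 1 bg bh; rewrite mul1r => <-.
by congr lam; apply/funext => n; rewrite mul1r.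
Qed.

Lemma pf_scale (a : R) g : rbounded g -> lam (fun n => a * g n) = a * lam g.
Proof.
move=> bg; have := pf_linear pf a bg (rbounded_cst 0); rewrite pf_zero addr0 => <-.
by congr lam; apply/funext => n; rewrite addr0.
Qed.

Lemma pf_mono g h : rbounded g -> rbounded h -> (forall n, g n <= h n) -> lam g <= lam h.
Proof.
move=> bg bh gh; have := pf_ge0 pf (rbounded_lin (-1) bg bh).
rewrite (pf_linear pf)// => /(_ _)/wrap[n|]; last by rewrite mulN1r; lra.
by rewrite mulN1r addrC subr_ge0.
Qed.

Definition ind A : nat -> R := fun k => (`[< A k >])%:R.
Definition meas A := lam (ind A).

Lemma ind01 A k : 0 <= ind A k <= 1.
Proof. by rewrite /ind; case: asbool; rewrite ?ler01 ?lexx. Qed.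

Lemma ind_ge0 A k : 0 <= ind A k.
Proof. by have /andP[] := ind01 A k. Qed.

Lemma ind_le1 A k : ind A k <= 1.
Proof. by have /andP[] := ind01 A k. Qed.

Lemma ind_bounded A : rbounded (ind A).
Proof. by exists 1 => n; have /andP[h0 h1] := ind01 A n; rewrite ger0_norm. Qed.

Lemma ind_in A k : A k -> ind A k = 1.
Proof. by move=> Ak; rewrite /ind asboolT. Qed.

Lemma ind_notin A k : ~ A k -> ind A k = 0.
Proof. by move=> Ak; rewrite /ind asboolF. Qed.

Lemma meas_ge0 A : 0 <= meas A.
Proof. by apply: (pf_ge0 pf) => [|n]; [exact: ind_bounded|have /andP[] := ind01 A n]. Qed.

Lemma meas_mono A B : A `<=` B -> meas A <= meas B.
Proof.
move=> AB; apply: pf_mono; [exact: ind_bounded|exact: ind_bounded|move=> k].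
have [Ak|Ak] := pselect (A k); first by rewrite !ind_in//; exact: AB.
by rewrite ind_notin//; have /andP[] := ind01 B k.
Qed.

Lemma meas_setU A B : A `&` B = set0 -> meas (A `|` B) = meas A + meas B.
Proof.
move=> AB; rewrite /meas -pf_add; [|exact: ind_bounded|exact: ind_bounded].
congr lam; apply/funext => k; have [Ak|Ak] := pselect (A k).
  rewrite ind_in; last by left.
  rewrite ind_in// ind_notin ?addr0// => Bk.
  by have : (A `&` B) k by []; rewrite AB.
rewrite [ind A k]ind_notin// add0r; have [Bk|Bk] := pselect (B k).
  by rewrite !ind_in//; right.
by rewrite !ind_notin// => -[].
Qed.

Lemma meas_subadd A B : meas (A `|` B) <= meas A + meas B.
Proof.
rewrite -(setDUK (@subsetUl _ A B)) meas_setU ?setDIK// lerD2l.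
by apply: meas_mono => k [[]].
Qed.

Lemma meas0 : meas set0 = 0.
Proof.
rewrite /meas (_ : ind set0 = fun=> 0) ?pf_zero//.
by apply/funext => k; rewrite ind_notin.
Qed.

Lemma meas_bigU (S : nat -> set nat) K :
  meas (fun n => exists2 s, (s < K)%N & S s n) <= \sum_(s < K) meas (S s).
Proof.
elim: K => [|K IH].
  rewrite big_ord0 (_ : (fun _ => _) = set0) ?meas0//.
  by apply/seteqP; split => // n [].
rewrite big_ord_recr/=; apply: le_trans (lerD IH (lexx _)).
apply: le_trans (meas_subadd _ _); apply: meas_mono => n [s].
by rewrite ltnS leq_eqVlt => /orP[/eqP->|sK] Ss; [right|left; exists s].
Qed.

End PositiveFunctionalTheory.

Arguments meas {R} lam A.

Lemma meas_le_dominated {R : realType} {X : completeNormedModType R[i]}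
    {v : X -> nat -> R[i]} {mu : X -> R[i]} {lam : (nat -> R) -> R}
    (af : abs_functional v mu lam) y A (c : R) :
  (forall n, normc (v y n) <= c * ind A n) -> normc (mu y) <= c * meas lam A.
Proof.
have pf := af_positive af.
move=> yA; apply: le_trans (af_le af y) _; rewrite /meas -(pf_scale pf); last exact: ind_bounded.
apply: (pf_mono pf) => //; last exact: (rbounded_scale c (ind_bounded A)).
have [M hM] := rbounded_scale c (ind_bounded A); exists M => n.
rewrite ger0_norm ?normc_ge0//; apply: le_trans (yA n) _.
by apply: le_trans (ler_norm _) (hM n).
Qed.

(** * Factoring the identity in the supremum norm *)

Section SupNormFactor.
Context {R : realType} {X : completeNormedModType R[i]} {v : X -> nat -> R[i]}.
Hypothesis mod_v : seq_model +oo False v.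
Variable T : bop X.
Variable lam : nat -> (nat -> R) -> R.
Hypothesis lamP : forall n, abs_functional v (fun x => v (T x) n) (lam n).

Let p1 : (1 <= +oo :> \bar R)%E. Proof. exact: leey. Qed.

(** With c i the value of T (y i) at N i, the map B : a |-> \sum_i (a_i / c_i) y_i, T, and
    the sampling E at the coordinates N i compose to an operator close to 1, because
    the other terms contribute little to the coordinate N i. *)
Lemma factor_of_separated (A : nat -> set nat) (N : nat -> nat) (y : nat -> X) (eps : R) :
  0 < eps -> (forall i j, i <> j -> A i `&` A j = set0) ->
  (forall i n, normc (v (y i) n) <= ind (A i) n) ->
  (forall i, eps <= normc (v (T (y i)) (N i))) ->
  (forall i, meas (lam (N i)) (\bigcup_(j in [set~ i]) A j) <= eps / 4) ->
  exists A B : bop X, A * T * B = 1.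
Proof.
move=> e0 disj yA ybig small.
have /choice[iota iotaP] : forall n, exists i, forall j, A j n -> j = i.
  move=> n; have [[i Ai]|none] := pselect (exists i, A i n); last first.
    by exists 0%N => j Aj; case: none; exists j.
  exists i => j Aj; apply: contrapT => ji.
  by have : (A j `&` A i) n by []; rewrite disj.
pose c i := v (T (y i)) (N i).
have c0 i : 0 < normc (c i) by exact: lt_le_trans (ybig i).
pose x n := v (y (iota n)) n / c (iota n).
have y_off i n : iota n != i -> v (y i) n = 0.
  move=> ni; apply: Normc.eq0_normc; apply/eqP; rewrite eq_le normc_ge0 andbT.
  apply: le_trans (yA i n) _; rewrite ind_notin// => /iotaP ini.
  by rewrite ini eqxx in ni.
have y1 i n : normc (v (y i) n) <= 1.
  by apply: le_trans (yA i n) _; exact: ind_le1.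
have xle n : normc (x n) <= eps^-1.
  rewrite /x Normc.normcM Normc.normcV -[leRHS]mul1r.
  apply: ler_pM; [exact: normc_ge0|by rewrite invr_ge0 normc_ge0|exact: y1|].
  by rewrite lef_pV2 ?posrE ?c0//; exact: ybig.
have [||//|B [BE _]] := @ex_synthesis _ _ _ _ _ p1 mod_v iota id x eps^-1.
- by rewrite invr_ge0 ltW.
- move=> k; apply: ge_ereal_sup => _ [n _ <-]; rewrite lee_fin /blk.
  by case: ifP => // _; rewrite Normc.normc0 invr_ge0 ltW.
have [|||E [EE Ele]] := @ex_operator _ _ _ _ _ p1 mod_v (fun x k => v x (N k)) 1.
- by move=> a z w k; exact: (sm_linear mod_v).
- by move=> z; rewrite mul1e; apply: ge_ereal_sup => _ [k _ <-]; exact: normc_le_lnorm.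
- by [].
have close a : nrm ((1 - E * T * B) a) <= 1 / 4 * nrm a.
  apply: (sup_norm_le mod_v) => i.
  have -> : v ((1 - E * T * B) a) i = v a i - v (T (B a)) (N i).
    by rewrite (sm_sub mod_v) EE.
  pose r := B a - (v a i / c i) *: y i.
  have Br : B a = (v a i / c i) *: y i + r by rewrite addrC subrK.
  rewrite Br bop_add bop_scale (sm_linear mod_v) divfK; last first.
    by apply/eqP => ci0; have := c0 i; rewrite ci0 Normc.normc0 ltxx.
  rewrite opprD addrA subrr add0r -scaleN1r.
  have -> : normc (-1 *: v (T r) (N i)) = normc (v (T r) (N i)).
    by rewrite Normc.normcM -[X in normc X](_ : (-1)%:C = _) ?normc_rec ?normrN1 ?mul1r// rmorphN1.
  have := meas_le_dominated (lamP (N i)) (y := r)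
    (A := \bigcup_(j in [set~ i]) A j) (c := nrm a / eps).
  move=> h; apply: le_trans (h _) _ => [n|]; last first.
    apply: le_trans (ler_wpM2l _ (small i)) _; first by rewrite divr_ge0 ?nrm_ge0 ?ltW.
    rewrite le_eqVlt; apply/orP; left; apply/eqP; by field; rewrite gt_eqF.
  rewrite (sm_sub mod_v) (sm_scale mod_v) BE /x.
  have [ni|ni] := eqVneq (iota n) i.
    rewrite ni (mulrC (v (y i) n)) mulrA subrr Normc.normc0.
    by rewrite mulr_ge0 ?divr_ge0 ?nrm_ge0 ?(ltW e0)//; exact: ind_ge0.
  rewrite [v (y i) n]y_off// mulr0 subr0.
  have [An|An] := pselect ((\bigcup_(j in [set~ i]) A j) n).
    rewrite ind_in// mulr1 Normc.normcM ler_pM ?normc_ge0//; first exact: (sm_coord p1 mod_v).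
    exact: xle.
  rewrite ind_notin// mulr0.
  have -> : v (y (iota n)) n = 0; last by rewrite mul0r mulr0 Normc.normc0.
  apply: Normc.eq0_normc; apply/eqP; rewrite eq_le normc_ge0 andbT.
  apply: le_trans (yA _ n) _; rewrite ind_notin// => Ai; apply: An; exists (iota n) => //.
  by move=> ini; rewrite /= ini eqxx in ni.
have half : (1 / 4 : R) < 1 by lra.
have [S GS] := neumann half close.
by exists E, (B * S); rewrite mulrA -GS subKr.
Qed.

Lemma meas_setT_le (c : R) n : 0 < c -> (forall x, nrm (T x) <= c * nrm x) ->
  meas (lam n) setT <= c.
Proof.
move=> c0 Tc; apply/ler_addgt0Pr => d d0.
have [y [y1 hy]] := af_approx (lamP n) (ind_bounded setT) (ind_ge0 setT) d0.
rewrite -lerBlDr; apply: le_trans hy _; apply: le_trans (sm_coord p1 mod_v _ _) _.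
apply: le_trans (Tc y) _; rewrite ger_pMr//; apply: (sup_norm_le mod_v) => k.
by apply: le_trans (y1 k) _; rewrite ind_in.
Qed.

Lemma factor_of_nonexhaustive (A : nat -> set nat) (N : nat -> nat) (eps : R) : 0 < eps ->
  (forall i j, i <> j -> A i `&` A j = set0) ->
  (forall i, eps <= meas (lam (N i)) (A i)) -> exists A B : bop X, A * T * B = 1.
Proof.
move=> e0 disj big; have [c c0 Tc] := bop_nrm T.
have meas_c n : meas (lam n) setT <= c by exact: meas_setT_le.
have d0 : 0 < eps / 8 by lra.
have [|||s [sinj sP]] := @rosenthal_disjointification R
    (fun k S => meas (lam (N k)) (\bigcup_(j in S) A j)) c (eps / 8) d0.
- by move=> k S; exact: meas_ge0 (af_positive (lamP _)) _.
- move=> k S S' SS'; rewrite bigcup_setU (meas_setU (af_positive (lamP _)))//.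
  apply/seteqP; split => // n [[i Si Ai] [j Sj Aj]].
  have ij : i <> j.
    move=> ij; have : (S `&` S') i by split => //; rewrite ij.
    by rewrite SS'.
  by have : (A i `&` A j) n by []; rewrite disj.
- by move=> k; apply: le_trans (meas_c (N k)); exact: meas_mono (af_positive (lamP _)) _ _ _.
have /choice[y yP] : forall i, exists y, (forall n, normc (v y n) <= ind (A (s i)) n) /\
    eps / 2 <= normc (v (T y) (N (s i))).
  move=> i; have e2 : 0 < eps / 2 by lra.
  have [y [yA hy]] := af_approx (lamP (N (s i))) (ind_bounded (A (s i)))
    (ind_ge0 (A (s i))) e2.
  exists y; split => //; apply: le_trans hy; have := big (s i); rewrite /meas; lra.
apply: (@factor_of_separated (A \o s) (N \o s) y (eps / 2)) => /=.
- by lra.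
- by move=> i j ij; apply: disj => /sinj.
- by move=> i n; have [] := yP i.
- by move=> i; have [] := yP i.
- move=> i; apply: le_trans (le_trans (sP i) _); last by lra.
  apply: (meas_mono (af_positive (lamP _))) => n [j ji Aj]; exists (s j) => //.
  by split; [exists j|move=> /sinj].
Qed.

End SupNormFactor.

(** * Uniform control of the coordinate measures *)

Section Control.
Context {R : realType} {X : completeNormedModType R[i]} {v : X -> nat -> R[i]}.
Hypothesis mod_v : seq_model +oo False v.
Variable T : bop X.
Variable lam : nat -> (nat -> R) -> R.
Hypothesis lamP : forall n, abs_functional v (fun x => v (T x) n) (lam n).
Hypothesis exhaustive : forall (A : nat -> set nat) (N : nat -> nat) (eps : R), 0 < eps ->
  (forall i j, i <> j -> A i `&` A j = set0) -> exists i, meas (lam (N i)) (A i) < eps.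

Let p1 : (1 <= +oo :> \bar R)%E. Proof. exact: leey. Qed.
Let pf n : positive_functional (lam n). Proof. exact: af_positive (lamP n). Qed.

Lemma disjoint_of_ltn (A : nat -> set nat) :
  (forall i j, (i < j)%N -> A i `&` A j = set0) ->
  forall i j, i <> j -> A i `&` A j = set0.
Proof.
move=> disj i j /eqP; rewrite neq_ltn => /orP[ij|ji]; first exact: disj.
by rewrite setIC disj.
Qed.

(** Otherwise the successive differences would be disjoint sets of measure more than eps. *)
Lemma decreasing_tail (C : nat -> set nat) (eps : R) : 0 < eps ->
  (forall i j, (i <= j)%N -> C j `<=` C i) ->
  exists r, forall r' n, (r <= r')%N -> meas (lam n) (C r `\` C r') <= eps.
Proof.
move=> e0 dec; apply: contrapT => bad.
have /choice[f fP] : forall r, exists sn : nat * nat,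
    (r <= sn.1)%N /\ eps < meas (lam sn.2) (C r `\` C sn.1).
  move=> r; apply: contrapT => h; apply: bad; exists r => r' n rr'.
  by rewrite leNgt; apply/negP => hn; apply: h; exists (r', n).
pose r i := iter i (fun r => (f r).1) 0%N.
have rmono : {homo r : i j / (i <= j)%N}.
  move=> i j /subnK <-; elim: (j - i)%N => // k IH.
  by rewrite addSn (leq_trans IH)//; have [] := fP (r (k + i)%N).
have [|i] := exhaustive (A := fun i => C (r i) `\` C (r i.+1)) (fun i => (f (r i)).2) e0.
  apply: disjoint_of_ltn => i j ij; apply/seteqP; split => // n [[_ nC] [Cn _]].
  by apply: nC; apply: dec Cn; exact: rmono.
by rewrite ltNge ltW//; have [] := fP (r i).
Qed.

(** Otherwise there are sets B k and indices N k such that B k is large for N k but nearly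
    null for all earlier indices.  They are made disjoint by removing from each B k
    finitely many later sets, up to a stage beyond which little more is lost for every
    measure, and then the earlier sets.  What is left contradicts exhaustivity.  Only
    finite unions occur, as the measures are not countably additive. *)
Lemma uniform_control (eps : R) : 0 < eps -> exists (F : seq nat) (d : R), 0 < d /\
  forall A, (forall m, m \in F -> meas (lam m) A <= d) -> forall n, meas (lam n) A <= eps.
Proof.
move=> e0; apply: contrapT => bad.
pose d k : R := 16^-1 * eps * 2^-1 ^+ k.
have d0 k : 0 < d k by rewrite mulr_gt0 ?exprn_gt0 ?mulr_gt0.
have dsum K : \sum_(k < K) d k <= eps / 8.
  by rewrite -mulr_sumr; have := @geometric_half_sum R K; nra.
have /choice[G GP] : forall Fk : seq nat * nat, exists An : set nat * nat,
    (forall m, m \in Fk.1 -> meas (lam m) An.1 <= d Fk.2) /\ eps < meas (lam An.2) An.1.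
  move=> [F k]; apply: contrapT => h; apply: bad; exists F, (d k); split => // A Ad n.
  by rewrite leNgt; apply/negP => hn; apply: h; exists (A, n).
pose F r := iteri r (fun k F => (G (F, k)).2 :: F) [::].
pose N r := (G (F r, r)).2; pose B r := (G (F r, r)).1.
have FS r : F r.+1 = N r :: F r by [].
have NF s r : (s < r)%N -> N s \in F r.
  elim: r => // r IH; rewrite ltnS leq_eqVlt FS inE => /orP[/eqP->|/IH ->].
    by rewrite eqxx.
  by rewrite orbT.
have Bsmall s r : (s < r)%N -> meas (lam (N s)) (B r) <= d r.
  by move=> sr; have [h _] := GP (F r, r); apply: h; exact: NF.
have Bbig r : eps < meas (lam (N r)) (B r) by have [_] := GP (F r, r).
pose C q r := B q `\` [set n | exists s, [/\ (q < s)%N, (s <= r)%N & B s n]].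
have Cdec q i j : (i <= j)%N -> C q j `<=` C q i.
  move=> ij n [Bn nB]; split => // -[s [qs si Bs]]; apply: nB; exists s; split => //.
  exact: leq_trans ij.
have /choice[r rP] : forall q, exists r, forall r' n, (r <= r')%N ->
    meas (lam n) (C q r `\` C q r') <= d q.
  by move=> q; apply: decreasing_tail => //; exact: Cdec.
pose D q := C q (r q).
pose E k := D k `\` [set n | exists2 q, (q < k)%N & D q n].
have e2 : 0 < eps / 2 by lra.
have [|k] := exhaustive (A := E) N e2.
  apply: disjoint_of_ltn => i j ij; apply/seteqP; split => // n [[Di _] [_ nD]].
  by apply: nD; exists i.
apply/negP; rewrite -leNgt; have := Bbig k.
pose S s := [set n | ((k < s)%N /\ B s n) \/ [/\ (s < k)%N, D s n & D k n]].
have Ssmall s : meas (lam (N k)) (S s) <= d s.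
  have [sk|ks|->] := ltngtP s k.
  - apply: le_trans (meas_mono (pf _) (B := D s `&` D k) _) _ => [n [[]|[_ Ds Dk]]//|].
      by rewrite ltnNge ltnW.
    have [kr|rk] := leqP k (r s).
      rewrite (_ : D s `&` D k = set0) ?(meas0 (pf _)) ?ltW//.
      apply/seteqP; split => // n [[_ nB] [Bk _]]; apply: nB; by exists k.
    apply: le_trans (rP s k (N k) (ltnW rk)); apply: (meas_mono (pf _)) => n [Ds [Bk _]].
    by split => // -[_ nB]; apply: nB; exists k.
  - apply: le_trans (Bsmall k s ks); apply: (meas_mono (pf _)) => n [[]//|[sk]].
    by rewrite ltnNge (ltnW ks) in sk.
  - rewrite (_ : S k = set0) ?(meas0 (pf _)) ?ltW//.
    by apply/seteqP; split => // n [[]|[]]; rewrite ltnn.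
pose K := maxn k (r k).+1.
(* Each index s accounts for what it takes from B k: all of B s when it comes later,
   the overlap of D s and D k when it comes earlier. *)
have cover : B k `<=` E k `|` (fun n => exists2 s, (s < K)%N & S s n).
  move=> n Bn.
  have [[s [ks sr Bs]]|nB] := pselect (exists s, [/\ (k < s)%N, (s <= r k)%N & B s n]).
    by right; exists s; [rewrite leq_max ltnS sr orbT|left].
  have Dk : D k n by split.
  have [[q qk Dq]|nD] := pselect (exists2 q, (q < k)%N & D q n); last by left; split.
  by right; exists q; [rewrite leq_max qk|right].
have := le_trans (meas_mono (pf (N k)) cover) (meas_subadd (pf (N k)) _ _).
have := meas_bigU (pf (N k)) S K.
have : \sum_(s < K) meas (lam (N k)) (S s) <= \sum_(s < K) d s by apply: ler_sum.
by have := dsum K; lra.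
Qed.

(** Where |x| exceeds eta the control of sets applies, by Markov's inequality; elsewhere x
    contributes at most eta times the norm of T. *)
Lemma functional_control (eps : R) : 0 < eps -> exists (Lam : (nat -> R) -> R) (d : R),
  [/\ 0 < d, positive_functional Lam & forall x, (forall n, normc (v x n) <= 1) ->
    Lam (fun n => normc (v x n)) <= d -> nrm (T x) <= eps].
Proof.
move=> e0; have [c c0 Tc] := bop_nrm T; have e2 : 0 < eps / 2 by lra.
have [F [d [d0 FP]]] := uniform_control e2.
pose eta := eps / (2 * c); have eta0 : 0 < eta by rewrite divr_gt0 ?mulr_gt0.
exists (fun g => \sum_(m <- F) lam m g), (d * eta); split.
- exact: mulr_gt0.
- split=> [a g h bg bh|g bg g0].
    by rewrite mulr_sumr -big_split; apply: eq_bigr => m _; rewrite (pf_linear (pf m)).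
  by apply: sumr_ge0 => m _; exact: (pf_ge0 (pf m)).
move=> x x1 xF.
have bx : rbounded (fun n => normc (v x n)) by exists 1 => n; rewrite ger0_norm ?normc_ge0.
pose A := [set n | eta < normc (v x n)].
have bA := @ind_bounded R A.
have lam_ge0 m : 0 <= lam m (fun n => normc (v x n)).
  by apply: (pf_ge0 (pf m)) => // n; exact: normc_ge0.
have Asmall m : m \in F -> meas (lam m) A <= d.
  move=> mF; rewrite -(ler_pM2r eta0); apply: le_trans xF.
  apply: (@le_trans _ _ (lam m (fun n => normc (v x n)))); last first.
    by rewrite (big_rem m)//= lerDl sumr_ge0.
  rewrite mulrC /meas -(pf_scale (pf m))//; apply: (pf_mono (pf m)) => //.
    exact: rbounded_scale.
  move=> n; have [An|An] := pselect (A n); first by rewrite ind_in// mulr1 ltW.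
  by rewrite ind_notin// mulr0 normc_ge0.
apply: (sup_norm_le mod_v) => n; apply: le_trans (af_le (lamP n) x) _.
have -> : eps = eps / 2 + eta * c by rewrite /eta; field; rewrite gt_eqF.
apply: (@le_trans _ _ (lam n (fun k => eta * ind setT k + ind A k))).
  apply: (pf_mono (pf n)) => //; first exact: rbounded_lin (ind_bounded _) bA.
  move=> k; rewrite ind_in// mulr1; have [Ak|/negP Ak] := pselect (A k).
    by rewrite ind_in// (le_trans (x1 k))// lerDr ltW.
  by rewrite ind_notin ?addr0 ?leNgt//; exact/negP.
rewrite (pf_linear (pf n) eta (ind_bounded _) bA) addrC.
by apply: lerD; [exact: FP|rewrite ler_pM2l//; apply: (meas_setT_le mod_v lamP n c0 Tc)].
Qed.

End Control.

(** * Nearly orthogonal differences *)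

Section NearOrthogonal.
Context {R : realType} {X : completeNormedModType R[i]} {v : X -> nat -> R[i]}.
Hypothesis mod_v : seq_model +oo False v.
Implicit Types z w : R[i].

Let p1 : (1 <= +oo :> \bar R)%E. Proof. exact: leey. Qed.

(** Real and imaginary part of the Hermitian product of z and w, conjugate-linear in w. *)
Definition inner_re z w : R := complex.Re z * complex.Re w + complex.Im z * complex.Im w.
Definition inner_im z w : R := complex.Im z * complex.Re w - complex.Re z * complex.Im w.

Lemma normc_sqr z : normc z ^+ 2 = complex.Re z ^+ 2 + complex.Im z ^+ 2.
Proof. by case: z => a b; rewrite /= sqr_sqrtr// addr_ge0 ?sqr_ge0. Qed.

Lemma normc_sqrD z w : normc (z + w) ^+ 2 = normc z ^+ 2 + normc w ^+ 2 + 2 * inner_re z w.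
Proof. by rewrite !normc_sqr /inner_re; case: z w => a b [c d] /=; ring. Qed.

Lemma inner_reM (t s z w : R[i]) : inner_re (t * z) (s * w) =
  inner_re t s * inner_re z w - inner_im t s * inner_im z w.
Proof.
by rewrite /inner_re /inner_im; case: t s z w => a b [c d] [a' b'] [c' d'] /=; ring.
Qed.

Lemma inner_re_le z w : `|inner_re z w| <= normc z * normc w.
Proof.
rewrite -(@ler_pXn2r _ 2)// ?nnegrE ?mulr_ge0 ?normc_ge0// exprMn !normc_sqr.
rewrite real_normK ?num_real// /inner_re; have := sqr_ge0 (inner_im z w); rewrite /inner_im.
by case: z w => a b [c d] /=; nra.
Qed.

Lemma inner_im_le z w : `|inner_im z w| <= normc z * normc w.
Proof.
rewrite -(@ler_pXn2r _ 2)// ?nnegrE ?mulr_ge0 ?normc_ge0// exprMn !normc_sqr.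
rewrite real_normK ?num_real// /inner_im; have := sqr_ge0 (inner_re z w); rewrite /inner_re.
by case: z w => a b [c d] /=; nra.
Qed.

Lemma inner_re_suml (I : Type) (r : seq I) (P : pred I) (F : I -> R[i]) w :
  inner_re (\sum_(i <- r | P i) F i) w = \sum_(i <- r | P i) inner_re (F i) w.
Proof.
elim/big_rec2: _ => [|i y S _ <-]; first by rewrite /inner_re !mul0r addr0.
by rewrite /inner_re; case: (F i) S => a b [c d] /=; ring.
Qed.

Lemma inner_re_half z w w' : inner_re z ((1 / 2)%:C * (w - w')) =
  (inner_re z w - inner_re z w') / 2.
Proof. by rewrite /inner_re; case: z w w' => a b [c d] [c' d'] /=; field. Qed.

Lemma inner_im_half z w w' : inner_im z ((1 / 2)%:C * (w - w')) =
  (inner_im z w - inner_im z w') / 2.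
Proof. by rewrite /inner_im; case: z w w' => a b [c d] [c' d'] /=; field. Qed.

Variable Lam : (nat -> R) -> R.
Hypothesis pf : positive_functional Lam.

Lemma rbounded_sum (K : nat) (g : nat -> nat -> R) : (forall l, (l < K)%N -> rbounded (g l)) ->
  rbounded (fun n => \sum_(l < K) g l n).
Proof.
elim: K => [|K IH] bg.
  by have := @rbounded_cst R 0; congr rbounded; apply/funext => n; rewrite big_ord0.
have := rbounded_add (IH (fun l lK => bg l (ltnW lK))) (bg K (ltnSn K)).
by congr rbounded; apply/funext => n; rewrite big_ord_recr.
Qed.

Lemma pf_sum (K : nat) (g : nat -> nat -> R) : (forall l, (l < K)%N -> rbounded (g l)) ->
  Lam (fun n => \sum_(l < K) g l n) = \sum_(l < K) Lam (g l).
Proof.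
elim: K => [|K IH] bg.
  by rewrite big_ord0 -[RHS](pf_zero pf); congr Lam; apply/funext => n; rewrite big_ord0.
have bg' l : (l < K)%N -> rbounded (g l) by move=> lK; apply: bg; exact: ltnW.
rewrite big_ord_recr/= -(IH bg') -(pf_add pf); [|exact: (rbounded_sum bg')|exact: bg].
by congr Lam; apply/funext => n; rewrite big_ord_recr.
Qed.

(** In the semi-inner product of Lam, orthogonal vectors of the unit ball would give the
    bound K (Lam 1).  Given z_0, ..., z_(K-1), the pigeonhole principle provides two
    terms of x with almost the same inner products with all of them, and half their
    difference is the next vector, orthogonal enough for an additional error of 1. *)
Lemma near_orthogonal_differences (x : nat -> X) (K : nat) :
  (forall i n, normc (v (x i) n) <= 1) -> exists z : nat -> X,
  (forall k, exists i j, (i < j)%N /\ z k = (1 / 2)%:C *: (x i - x j)) /\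
  forall theta : nat -> R[i], (forall k, normc (theta k) <= 1) ->
    Lam (fun n => normc (\sum_(k < K) theta k * v (z k) n) ^+ 2) <=
      K%:R * (Lam (fun=> 1) + 1).
Proof.
move=> x1; elim: K => [|K [z [zP zLam]]].
  exists (fun=> (1 / 2)%:C *: (x 0%N - x 1%N)); split; first by move=> k; exists 0%N, 1%N.
  move=> theta _; rewrite mul0r (_ : (fun _ => _) = fun=> 0) ?(pf_zero pf)//.
  by apply/funext => n; rewrite big_ord0 Normc.normc0 expr0n.
have z1 k n : normc (v (z k) n) <= 1.
  have [i [j [_ ->]]] := zP k; rewrite (sm_scale mod_v) (sm_sub mod_v).
  exact: normc_half_sub.
have bdd_re (u w : X) : (forall n, normc (v u n) <= 1) -> (forall n, normc (v w n) <= 1) ->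
    rbounded (fun n => inner_re (v u n) (v w n)).
  move=> u1 w1; exists 1 => n; apply: le_trans (inner_re_le _ _) _.
  by rewrite -[leRHS]mulr1 ler_pM ?normc_ge0.
have bdd_im (u w : X) : (forall n, normc (v u n) <= 1) -> (forall n, normc (v w n) <= 1) ->
    rbounded (fun n => inner_im (v u n) (v w n)).
  move=> u1 w1; exists 1 => n; apply: le_trans (inner_im_le _ _) _.
  by rewrite -[leRHS]mulr1 ler_pM ?normc_ge0.
have Lam_le (g : nat -> R) : rbounded g -> (forall n, `|g n| <= 1) -> `|Lam g| <= Lam (fun=> 1).
  move=> bg g1; have b1 := @rbounded_cst R 1.
  have h1 : Lam g <= Lam (fun=> 1).
    by apply: (pf_mono pf) => // n; apply: le_trans (ler_norm _) (g1 n).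
  have h2 : Lam (fun n => -1 * g n) <= Lam (fun=> 1).
    apply: (pf_mono pf) => //; first exact: rbounded_scale.
    by move=> n; rewrite mulN1r; apply: le_trans (ler_norm _) _; rewrite normrN.
  rewrite (pf_scale pf)// in h2; rewrite ler_norml; lra.
pose d : R := (2 * (K%:R + 1))^-1.
have d0 : 0 < d by rewrite invr_gt0 mulr_gt0// ltr_wpDl.
have [|F1 [c1 c1P]] := @real_coloring R nat K
    (fun l i => Lam (fun n => inner_re (v (z l) n) (v (x i) n))) d d0.
  move=> l _; exists (Lam (fun=> 1)) => i; apply: Lam_le; first exact: bdd_re.
  by move=> n; apply: le_trans (inner_re_le _ _) _; rewrite -[leRHS]mulr1 ler_pM ?normc_ge0.
have [|F2 [c2 c2P]] := @real_coloring R nat K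
    (fun l i => Lam (fun n => inner_im (v (z l) n) (v (x i) n))) d d0.
  move=> l _; exists (Lam (fun=> 1)) => i; apply: Lam_le; first exact: bdd_im.
  by move=> n; apply: le_trans (inner_im_le _ _) _; rewrite -[leRHS]mulr1 ler_pM ?normc_ge0.
have [i [j [ij [ij1 ij2]]]] := pigeonhole (fun i => (c1 i, c2 i)).
pose zK := (1 / 2)%:C *: (x i - x j).
have zK1 n : normc (v zK n) <= 1.
  by rewrite (sm_scale mod_v) (sm_sub mod_v); exact: normc_half_sub.
pose z' k := if (k < K)%N then z k else zK.
have z'K : z' K = zK by rewrite /z' ltnn.
have z'lt k : (k < K)%N -> z' k = z k by rewrite /z' => ->.
exists z'; split.
  move=> k; rewrite /z'; case: ifP => _; [exact: zP|by exists i, j].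
move=> theta theta1.
have small_re l : (l < K)%N -> `|Lam (fun n => inner_re (v (z l) n) (v zK n))| <= d / 2.
  move=> lK; have := c1P _ _ ij1 l lK.
  have -> : Lam (fun n => inner_re (v (z l) n) (v zK n)) =
      (Lam (fun n => inner_re (v (z l) n) (v (x i) n)) -
       Lam (fun n => inner_re (v (z l) n) (v (x j) n))) / 2.
    have bi := bdd_re _ _ (z1 l) (x1 i); have bj := bdd_re _ _ (z1 l) (x1 j).
    rewrite -[X in _ - X]mul1r -mulNr addrC -(pf_linear pf)// mulrC -(pf_scale pf).
      2: exact: rbounded_lin.
    by congr Lam; apply/funext => n; rewrite (sm_scale mod_v) (sm_sub mod_v) inner_re_half; field.
  by move=> h; rewrite normrM [`|2^-1|]ger0_norm// ler_pM2r.
have small_im l : (l < K)%N -> `|Lam (fun n => inner_im (v (z l) n) (v zK n))| <= d / 2.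
  move=> lK; have := c2P _ _ ij2 l lK.
  have -> : Lam (fun n => inner_im (v (z l) n) (v zK n)) =
      (Lam (fun n => inner_im (v (z l) n) (v (x i) n)) -
       Lam (fun n => inner_im (v (z l) n) (v (x j) n))) / 2.
    have bi := bdd_im _ _ (z1 l) (x1 i); have bj := bdd_im _ _ (z1 l) (x1 j).
    rewrite -[X in _ - X]mul1r -mulNr addrC -(pf_linear pf)// mulrC -(pf_scale pf).
      2: exact: rbounded_lin.
    by congr Lam; apply/funext => n; rewrite (sm_scale mod_v) (sm_sub mod_v) inner_im_half; field.
  by move=> h; rewrite normrM [`|2^-1|]ger0_norm// ler_pM2r.
pose w n := \sum_(k < K) theta k * v (z k) n.
pose re l := inner_re (theta l) (theta K); pose im l := inner_im (theta l) (theta K).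
pose cross l n := 2 * re l * inner_re (v (z l) n) (v zK n) +
  (- 2 * im l) * inner_im (v (z l) n) (v zK n).
have expand : (fun n => normc (\sum_(k < K.+1) theta k * v (z' k) n) ^+ 2) =
    (fun n => (normc (w n) ^+ 2 + normc (theta K * v zK n) ^+ 2) + \sum_(l < K) cross l n).
  apply/funext => n; rewrite big_ord_recr/= z'K (eq_bigr (fun k : 'I_K => theta k * v (z k) n)).
    rewrite normc_sqrD; congr (_ + _); rewrite inner_re_suml mulr_sumr; apply: eq_bigr => l _.
    by rewrite inner_reM /cross /re /im; ring.
  by move=> k _; rewrite z'lt.
have bcross l : (l < K)%N -> rbounded (cross l).
  move=> lK; apply: rbounded_lin; first exact: bdd_re.
  by apply: rbounded_scale; exact: bdd_im.
have wK n : normc (w n) <= K%:R.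
  rewrite -[leRHS]mul1r -[X in _ * X%:R]card_ord -sumr_const mulr_sumr.
  apply: le_trans (ler_normc_sum _ _ _) _; apply: ler_sum => k _.
  by rewrite Normc.normcM ler_pM ?normc_ge0.
have bw : rbounded (fun n => normc (w n) ^+ 2).
  by exists (K%:R ^+ 2) => n; rewrite ger0_norm ?exprn_ge0 ?normc_ge0// lerXn2r ?nnegrE ?normc_ge0.
have tz1 n : normc (theta K * v zK n) ^+ 2 <= 1.
  by rewrite exprn_ile1 ?normc_ge0// Normc.normcM -[leRHS]mulr1 ler_pM ?normc_ge0.
have btz : rbounded (fun n => normc (theta K * v zK n) ^+ 2).
  by exists 1 => n; rewrite ger0_norm ?exprn_ge0 ?normc_ge0.
rewrite expand (pf_add pf); [|exact: rbounded_add|exact: (rbounded_sum bcross)].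
rewrite (pf_add pf)// (pf_sum bcross).
have h1 : Lam (fun n => normc (w n) ^+ 2) <= K%:R * (Lam (fun=> 1) + 1) by exact: zLam.
have h2 : Lam (fun n => normc (theta K * v zK n) ^+ 2) <= Lam (fun=> 1).
  by apply: (pf_mono pf) => //; exact: rbounded_cst.
have h3 : \sum_(l < K) Lam (cross l) <= 1.
  apply: (@le_trans _ _ (\sum_(l < K) 2 * d)).
    apply: ler_sum => l _; have lK := ltn_ord l.
    have br := bdd_re _ _ (z1 l) zK1; have bi := bdd_im _ _ (z1 l) zK1.
    rewrite /cross (pf_linear pf)//; last exact: rbounded_scale.
    rewrite (pf_scale pf)//.
    have r1 : `|re l| <= 1.
      by apply: le_trans (inner_re_le _ _) _; rewrite -[leRHS]mulr1 ler_pM ?normc_ge0.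
    have i1 : `|im l| <= 1.
      by apply: le_trans (inner_im_le _ _) _; rewrite -[leRHS]mulr1 ler_pM ?normc_ge0.
    have := small_re l lK; have := small_im l lK.
    set P := Lam _; set Q := Lam _ => Ple Qle.
    have e1 : re l * Q <= d / 2.
      by apply: le_trans (ler_norm _) _; rewrite normrM -[leRHS]mul1r ler_pM.
    have e2 : - (im l * P) <= d / 2.
      by apply: le_trans (ler_norm _) _; rewrite normrN normrM -[leRHS]mul1r ler_pM.
    lra.
  have K1 : 0 < K%:R + 1 :> R by rewrite ltr_wpDl.
  have dE : 2 * d = (K%:R + 1)^-1 by rewrite /d; field; rewrite gt_eqF.
  by rewrite sumr_const card_ord -[leLHS]mulr_natr dE mulrC ler_pdivrMr ?mul1r ?lerDl.
rewrite -natr1; lra.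
Qed.

End NearOrthogonal.

(** * Approximation of the square in the supremum norm *)

Section SquareApproximable.
Context {R : realType} {X : completeNormedModType R[i]} {v : X -> nat -> R[i]}.
Hypothesis mod_v : seq_model +oo False v.
Variable T : bop X.

Let p1 : (1 <= +oo :> \bar R)%E. Proof. exact: leey. Qed.

Hypothesis control : forall eps : R, 0 < eps -> exists (Lam : (nat -> R) -> R) (d : R),
  [/\ 0 < d, positive_functional Lam & forall x, (forall n, normc (v x n) <= 1) ->
    Lam (fun n => normc (v x n)) <= d -> nrm (T x) <= eps].

Lemma unit_ball_sequence x : nrm x <= 1 -> forall n, normc (v x n) <= 1.
Proof. by move=> x1 n; apply: le_trans x1; exact: (sm_coord p1 mod_v). Qed.

(** At a coordinate n choose unimodular factors theta k aligning the values of T (z k).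
    The mean W of the theta k (z k) has small mean square, hence small integral, so
    T W is small, and its n-th coordinate is the mean of the moduli. *)
Lemma averaged_images_small (x : nat -> X) (eps : R) : 0 < eps -> (forall i, nrm (x i) <= 1) ->
  exists (K : nat) (z : nat -> X), [/\ (0 < K)%N,
    forall k, exists i j, (i < j)%N /\ z k = (1 / 2)%:C *: (x i - x j) &
    forall n, \sum_(k < K) normc (v (T (z k)) n) <= K%:R * eps].
Proof.
move=> e0 x1; have [Lam [d [d0 pf LamT]]] := control e0.
have L0 : 0 <= Lam (fun=> 1) by apply: (pf_ge0 pf) => //; exact: rbounded_cst.
set L := Lam (fun=> 1) in L0; pose a := d / (L + 1).
have a0 : 0 < a by rewrite divr_gt0// ltr_wpDl.
pose K := (Num.truncn ((L + 1) / (a * d))).+1.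
have Kbig : (L + 1) / (a * d) < K%:R.
  by have /andP[] := truncn_itv (divr_ge0 (addr_ge0 L0 ler01) (ltW (mulr_gt0 a0 d0))).
have K0 : 0 < K%:R :> R by rewrite ltr0n.
have [z [zP zLam]] := near_orthogonal_differences mod_v pf K (fun i => unit_ball_sequence (x1 i)).
exists K, z; split => // n.
have z1 k m : normc (v (z k) m) <= 1.
  have [i [j [_ ->]]] := zP k; rewrite (sm_scale mod_v) (sm_sub mod_v).
  by apply: normc_half_sub; apply: unit_ball_sequence.
have /choice[theta thetaP] : forall k, exists w : R[i], normc w = 1 /\
    w * v (T (z k)) n = (normc (v (T (z k)) n))%:C.
  by move=> k; have [w w1 wE] := phaseP (v (T (z k)) n); exists w.
pose W := (K%:R^-1)%:C *: \sum_(k < K) theta k *: z k.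
have WE m : v W m = (K%:R^-1)%:C * \sum_(k < K) theta k * v (z k) m.
  rewrite (sm_scale mod_v) (sm_sum mod_v); congr (_ * _); apply: eq_bigr => k _.
  exact: (sm_scale mod_v).
have normW m : normc (v W m) = K%:R^-1 * normc (\sum_(k < K) theta k * v (z k) m).
  by rewrite WE Normc.normcM normc_rec ger0_norm// invr_ge0 ltW.
have sumK m : normc (\sum_(k < K) theta k * v (z k) m) <= K%:R.
  rewrite -[leRHS]mul1r -[X in _ * X%:R]card_ord -sumr_const mulr_sumr.
  apply: le_trans (ler_normc_sum _ _ _) _; apply: ler_sum => k _.
  by have [t1 _] := thetaP k; rewrite Normc.normcM t1 !mul1r.
have W1 m : normc (v W m) <= 1 by rewrite normW mulrC ler_pdivrMr// mul1r.
have TW : nrm (T W) <= eps.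
  apply: LamT => //.
  pose g m := normc (\sum_(k < K) theta k * v (z k) m) ^+ 2.
  have gle : Lam g <= K%:R * (L + 1).
    by apply: zLam => k; have [-> _] := thetaP k.
  have bg : rbounded g.
    exists (K%:R ^+ 2) => m; rewrite ger0_norm ?exprn_ge0 ?normc_ge0//.
    by rewrite lerXn2r ?nnegrE ?normc_ge0.
  have bW : rbounded (fun m => normc (v W m)).
    by exists 1 => m; rewrite ger0_norm ?normc_ge0.
  have b1 := @rbounded_cst R (a / 2).
  pose t := (2 * a * K%:R ^+ 2)^-1.
  have t0 : 0 < t by rewrite invr_gt0; apply: mulr_gt0; [exact: mulr_gt0|exact: exprn_gt0].
  (* Pointwise arithmetic-geometric mean with weight a. *)
  have : Lam (fun m => normc (v W m)) <= Lam (fun m => t * g m + a / 2 * 1).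
    apply: (pf_mono pf) => //.
      by apply: rbounded_lin => //; exact: rbounded_cst.
    move=> m; rewrite normW /g /t; set s := normc _.
    have -> : (2 * a * K%:R ^+ 2)^-1 * s ^+ 2 = (K%:R^-1 * s) ^+ 2 / (2 * a).
      by field; rewrite !gt_eqF.
    set u := _ * s; rewrite -subr_ge0.
    have -> : u ^+ 2 / (2 * a) + a / 2 * 1 - u = (u - a) ^+ 2 / (2 * a).
      by field; rewrite gt_eqF.
    by rewrite divr_ge0 ?sqr_ge0// mulr_ge0// ltW.
  rewrite (pf_linear pf)//; last by apply: rbounded_scale; exact: rbounded_cst.
  rewrite (pf_scale pf); last exact: rbounded_cst.
  rewrite -/L => h; apply: le_trans h _.
  have h1 : t * Lam g <= d / 2.
    apply: (@le_trans _ _ (t * (K%:R * (L + 1)))); first by rewrite ler_pM2l.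
    have -> : t * (K%:R * (L + 1)) = (L + 1) / a / (2 * K%:R).
      by rewrite /t; field; rewrite !gt_eqF.
    rewrite ler_pdivrMr ?mulr_gt0//.
    have -> : d / 2 * (2 * K%:R) = d * K%:R by field.
    have := ltW Kbig; rewrite (ler_pdivrMr _ _ (mulr_gt0 a0 d0)) => hK.
    rewrite ler_pdivrMr//; apply: le_trans hK _; rewrite le_eqVlt.
    by apply/orP; left; apply/eqP; ring.
  have h2 : a / 2 * L <= d / 2.
    have -> : a / 2 * L = d / 2 * (L / (L + 1)).
      by rewrite /a; field; rewrite gt_eqF// ltr_wpDl.
    have L10 : 0 < L + 1 by rewrite ltr_wpDl.
    by rewrite ger_pMr ?divr_gt0// ler_pdivrMr// mul1r lerDl.
  lra.
have : normc (v (T W) n) <= eps by apply: le_trans TW; exact: (sm_coord p1 mod_v).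
have -> : v (T W) n = (K%:R^-1 * \sum_(k < K) normc (v (T (z k)) n))%:C.
  rewrite /W bop_scale bop_sum (sm_scale mod_v) (sm_sum mod_v) rmorphM rmorph_sum.
  congr (_ * _); apply: eq_bigr => k _; rewrite bop_scale (sm_scale mod_v).
  by have [_ ->] := thetaP k.
rewrite normc_rec ger0_norm; last first.
  by rewrite mulr_ge0 ?invr_ge0 ?(ltW K0)// sumr_ge0// => k _; exact: normc_ge0.
by rewrite ler_pdivrMl.
Qed.

(** Integrating the averages of the moduli of T (z k) against the functional that
    controls T shows that for one k the integral of |T (z k)| is small. *)
Lemma square_almost_repetition (x : nat -> X) (eta : R) : 0 < eta -> (forall i, nrm (x i) <= 1) ->
  exists i j, (i < j)%N /\ nrm (T (T (x i - x j))) <= eta.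
Proof.
move=> eta0 x1; have [c c0 Tc] := bop_nrm T.
have e0 : 0 < eta / (2 * c) by rewrite divr_gt0 ?mulr_gt0.
have [Lam [d [d0 pf LamT]]] := control e0.
have L0 : 0 <= Lam (fun=> 1) by apply: (pf_ge0 pf) => //; exact: rbounded_cst.
set L := Lam (fun=> 1) in L0.
have e'0 : 0 < d * c / (L + 1) by rewrite divr_gt0 ?mulr_gt0// ltr_wpDl.
have [K [z [K0 zP avg]]] := averaged_images_small e'0 x1.
have z1 k : nrm (z k) <= 1.
  have [i [j [_ ->]]] := zP k; rewrite nrmZ normc_rec ger0_norm//.
  by have := nrmB (x i) (x j); have := x1 i; have := x1 j; lra.
pose y k := c^-1%:C *: T (z k).
have y1 k n : normc (v (y k) n) <= 1.
  apply: unit_ball_sequence; rewrite nrmZ normc_rec ger0_norm ?invr_ge0 ?(ltW c0)//.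
  rewrite mulrC ler_pdivrMr// mul1r (le_trans (Tc _))// ger_pMr//.
have [[k [kK yk]]|none] := pselect (exists k, (k < K)%N /\ Lam (fun n => normc (v (y k) n)) <= d).
  have [i [j [ij zE]]] := zP k; exists i, j; split => //.
  have -> : x i - x j = 2%:C *: z k.
    by rewrite zE scalerA -rmorphM (_ : 2 * (1 / 2) = 1 :> R) ?scale1r//; field.
  have -> : T (2%:C *: z k) = (2 * c)%:C *: y k.
    by rewrite bop_scale /y scalerA -rmorphM mulfK// gt_eqF.
  rewrite bop_scale nrmZ normc_rec gtr0_norm ?mulr_gt0// mulrC -ler_pdivlMr ?mulr_gt0//.
  exact: LamT.
exfalso; have big k : (k < K)%N -> d < Lam (fun n => normc (v (y k) n)).
  by move=> kK; rewrite ltNge; apply/negP => h; apply: none; exists k.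
have bdd_y k : (k < K)%N -> rbounded (fun n => normc (v (y k) n)).
  by move=> _; exists 1 => n; rewrite ger0_norm ?normc_ge0.
have := pf_sum pf bdd_y.
have h1 : K%:R * d <= \sum_(k < K) Lam (fun n => normc (v (y k) n)).
  rewrite -[K in K%:R]card_ord mulr_natl -sumr_const; apply: ler_sum => k _.
  by apply: ltW; exact: big.
have h2 : Lam (fun n => \sum_(k < K) normc (v (y k) n)) <= (K%:R * d / (L + 1)) * L.
  rewrite -(pf_scale pf); last exact: rbounded_cst.
  apply: (pf_mono pf); [exact: (rbounded_sum bdd_y)|by apply: rbounded_scale; exact: rbounded_cst|].
  move=> n; rewrite mulr1.
  have -> : \sum_(k < K) normc (v (y k) n) = c^-1 * \sum_(k < K) normc (v (T (z k)) n).
    rewrite mulr_sumr; apply: eq_bigr => k _.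
    by rewrite (sm_scale mod_v) Normc.normcM normc_rec ger0_norm// invr_ge0 ltW.
  rewrite mulrC ler_pdivrMr//; apply: le_trans (avg n) _.
  by rewrite le_eqVlt; apply/orP; left; apply/eqP; field; rewrite gt_eqF// ltr_wpDl.
move=> h3; have : K%:R * d <= (K%:R * d / (L + 1)) * L by lra.
have Kd : 0 < K%:R * d by rewrite mulr_gt0// ltr0n.
have L10 : 0 < L + 1 by rewrite ltr_wpDl.
by rewrite mulrAC ler_pdivlMr// ler_pM2l//; lra.
Qed.

(** A greedy choice of separated points would contradict the preceding lemma. *)
Lemma square_totally_bounded (eta : R) : 0 < eta -> exists s : seq X,
  forall x, nrm x <= 1 -> exists2 y, y \in s & nrm (T (T (x - y))) <= eta.
Proof.
move=> eta0; apply: contrapT => bad.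
have /choice[f fP] : forall s : seq X, exists x, nrm x <= 1 /\
    forall y, y \in s -> eta < nrm (T (T (x - y))).
  move=> s; apply: contrapT => h; apply: bad; exists s => x x1.
  apply: contrapT => h'; apply: h; exists x; split => // y ys.
  by rewrite ltNge; apply/negP => hy; apply: h'; exists y.
pose s k := iter k (fun s => f s :: s) [::].
have mem i j : (i < j)%N -> f (s i) \in s j.
  elim: j => // j IH; rewrite ltnS leq_eqVlt /= inE => /orP[/eqP->|/IH ->].
    by rewrite eqxx.
  by rewrite orbT.
have [i|i [j [ij]]] := square_almost_repetition (x := fun k => f (s k)) eta0.
  by have [] := fP (s i).
move=> le_eta; have [_ /(_ _ (mem i j ij))] := fP (s j).
by rewrite ltNge => /negP; apply; rewrite !bop_sub nrm_distC -!bop_sub.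
Qed.

(** Replace T^2 y by the function that takes, on each class of a finite coloring of the
    coordinates, its value at a representative of the class.  On the points of a finite
    net for T^2 this changes little if the coloring is fine enough. *)
Lemma square_approximable : exists F (c : R), [/\ finrank (fun m x => v x m) F, c < 1 &
  forall x, nrm ((T * T - F) x) <= c * nrm x].
Proof.
have e8 : 0 < 1 / 8 :> R by lra.
have [s sP] := square_totally_bounded e8.
have [|C [col colP]] := @complex_coloring R nat (size s) (fun i n => v (T (T (nth 0 s i))) n) _ e8.
  by move=> i _; exists (nrm (T (T (nth 0 s i)))) => n; exact: (sm_coord p1 mod_v).
have /choice[rep repP] : forall c : C, exists a, forall n, col n = c -> col a = c.
  by move=> c; have [[a ac]|none] := pselect (exists a, col a = c);
     [exists a|exists 0%N => n nc; case: none; exists n].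
have repE n : col (rep (col n)) = col n by exact: repP erefl.
have [c c0 TTc] := bop_nrm (T * T).
have [|||F [FE Fle]] := @ex_operator _ _ _ _ _ p1 mod_v (fun y n => v (T (T y)) (rep (col n))) c.
- by move=> a y z n; rewrite !bop_add !bop_scale (sm_linear mod_v).
- move=> y; rewrite (sm_norm mod_v) -EFinM; apply: ge_ereal_sup => _ [n _ <-].
  rewrite lee_fin; apply: le_trans (sm_coord p1 mod_v _ _) _; exact: TTc.
- by [].
have /choice[one oneE] : forall c : C, exists x, v x = fun n => (col n == c)%:R.
  move=> c'; apply: (ex_bounded_sequence mod_v (c := 1)) => n.
  by case: (col n == c'); [rewrite [normc _]Normc.normc1|rewrite [normc _]Normc.normc0 ler01].
have finF : finrank (fun m x => v x m) F.
  exists [seq (rep c', one c', T * T) | c' <- enum C] => y; rewrite big_map /=.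
  apply: (sm_inj p1 mod_v) => n; rewrite FE (sm_sum mod_v).
  rewrite (bigD1_seq (col n)) ?mem_enum ?enum_uniq//=.
  rewrite (sm_scale mod_v) oneE eqxx mulr1 big1 ?addr0// => c' c'n.
  by rewrite (sm_scale mod_v) oneE eq_sym (negbTE c'n) mulr0.
exists F, (1 / 2); split => //; first by lra.
(* The error 1/8 enters three times: from x to y, along the class, and back. *)
have unit x : nrm x <= 1 -> nrm ((T * T - F) x) <= 3 / 8.
  move=> x1; have [y ys hy] := sP x x1; apply: (sup_norm_le mod_v) => n.
  rewrite bopBE (sm_sub mod_v) FE bopME.
  have close m : normc (v (T (T x)) m - v (T (T y)) m) <= 1 / 8.
    rewrite -(sm_sub mod_v) -!bop_sub; apply: le_trans hy; exact: (sm_coord p1 mod_v).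
  have := colP n (rep (col n)) (esym (repE n)) (index y s).
  rewrite index_mem nth_index// => /(_ ys).
  move: (close n) (close (rep (col n))).
  set a := v _ n; set a' := v _ n; set b := v _ _; set b' := v _ _ => h1 h2 h3.
  have -> : a - b = (a - a') + (a' - b') - (b - b') by ring.
  apply: le_trans (ler_normcB _ _) _; have := ler_normcD (a - a') (a' - b'); lra.
move=> x; have [->|x0] := eqVneq x 0; first by rewrite bop_zero nrm0 mulr0.
have nx0 := nrm_gt0 x0.
have := unit ((nrm x)^-1%:C *: x); rewrite bop_scale !nrmZ normc_rec.
rewrite ger0_norm ?invr_ge0 ?(ltW nx0)//.
rewrite mulVf ?gt_eqF// lexx => /(_ isT); rewrite mulrC ler_pdivrMr//; lra.
Qed.

End SquareApproximable.

Section SupNormDichotomy.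
Context {R : realType} {X : completeNormedModType R[i]} {v : X -> nat -> R[i]}.
Hypothesis mod_v : seq_model +oo False v.

Lemma factor_or_square_finrank (T : bop X) : (exists A B, A * T * B = 1) \/
  (exists F (c : R), [/\ finrank (fun m x => v x m) F, c < 1 &
     forall x, nrm ((T * T - F) x) <= c * nrm x]).
Proof.
have p1 : (1 <= +oo :> \bar R)%E by exact: leey.
have [c c0 Tc] := bop_nrm T.
have /choice[lam lamP] : forall n, exists lam, abs_functional v (fun x => v (T x) n) lam.
  move=> n; apply: (ex_abs_functional mod_v (c := c)) => [a x y|x].
    by rewrite bop_add bop_scale (sm_linear mod_v).
  by apply: le_trans (Tc x); exact: (sm_coord p1 mod_v).
have [fac|nofac] := pselect (exists A B : bop X, A * T * B = 1); first by left.
right; apply: square_approximable => //.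
apply: (functional_control mod_v lamP) => A N eps e0 disj.
apply: contrapT => h; apply: nofac.
apply: (factor_of_nonexhaustive mod_v lamP e0 disj (N := N)) => i.
by rewrite leNgt; apply/negP => hi; apply: h; exists i.
Qed.

End SupNormDichotomy.

(** * The spaces of the theorem *)

Section SequenceSpaces.
Context {R : realType}.

Lemma SHAI_seq_model (p : \bar R) (b : Prop) (X : completeNormedModType R[i])
    (v : X -> nat -> R[i]) : (1 <= p)%E -> seq_model p b v ->
  (forall T : bop X, (exists A B, A * T * B = 1) \/
    (exists F (c : R), [/\ finrank (fun m x => v x m) F, c < 1 &
       forall x, nrm ((T * T - F) x) <= c * nrm x])) ->
  SHAI X.
Proof.
move=> p1 mod_v dich; apply: (SHAI_dichotomy _ _ _ (ex_square_decomposition p1 mod_v) dich).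
- by move=> m a x y; exact: (sm_linear mod_v).
- by move=> m x; exact: (sm_coord p1 mod_v).
- by move=> x; exact: (sm_eq0 p1 mod_v).
Qed.

Lemma SHAI_vanishing_tails (p : \bar R) (X : completeNormedModType R[i])
    (v : X -> nat -> R[i]) : (1 <= p)%E -> seq_model p True v -> SHAI X.
Proof.
move=> p1 mod_v; apply: (SHAI_seq_model p1 mod_v) => T.
have [[A [B ATB]]|] := factor_or_finrank_tails p1 mod_v (T * T); last by right.
by left; exists (A * T), B; rewrite -[A * T * T]mulrA.
Qed.

Lemma c0_model : seq_model +oo True (@c0_val R).
Proof.
split.
- by [].
- by move=> x; rewrite -c0_fineK.
- move=> _ x e e0; have [N _ HN] := (c0_near x).1 (c0_cvg x) e e0; exists N.
  apply: ge_ereal_sup => _ [n _ <-]; rewrite lee_fin /tail; case: ltnP => [_|/HN//].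
  by rewrite Normc.normc0 ltW.
move=> f _ /(_ I) ftails; have fc0 : f \in @c0_pred R; last by exists (C0Space fc0).
apply/asboolP/c0_near => e e0; have [N HN] := ftails e e0; exists N => // n /= Nn.
rewrite -lee_fin; apply: le_trans HN; have := normc_le_lnorm (tail N f) n (leey _).
by rewrite {1}/tail ltnNge Nn.
Qed.

Lemma lp_model (p : \bar R) (p1 : (1 <= p)%E) (b : Prop) : (b -> p != +oo%E) ->
  seq_model p b (@lp_val R p p1).
Proof.
move=> bp; split.
- by [].
- by move=> x; rewrite -lp_fineK.
- move=> /bp pfin x; have := lp_lty x; case: p p1 pfin x {bp} => [r| |] // p1 _ x xfin.
  by apply: lnorm_tail_cvg.
- by move=> f ffin _; exists (@LpSpace R p p1 f ffin).
Qed.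

End SequenceSpaces.

Theorem proposition1p2 (R : realType) :
  SHAI (c0_space R) /\
  forall (p : \bar R) (p1 : (1 <= p)%E), SHAI (lp_space p1).
Proof.
split; first exact: SHAI_vanishing_tails (leey _) c0_model.
move=> p p1; have [pfin|/negPn/eqP poo] := boolP (p != +oo%E).
  exact: SHAI_vanishing_tails p1 (lp_model p1 (fun=> pfin)).
subst p; have mod_v := lp_model p1 (False_ind _).
exact: SHAI_seq_model p1 mod_v (factor_or_square_finrank mod_v).
Qed.
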